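(* Let $n$ be a positive integer. Let $\Phi_i\in \mathcal{U} \cap \nabla_{2}$, $i=1,2,\dots,n$, and $\Psi\in \widetilde{\mathcal{U}}$. Suppose that $0\le \alpha<nd$ and that $t\mapsto\frac{\Psi(t)}{\Phi_i(t)}$ is nondecreasing for every $i=1,\dots,n$. Let $\sigma_1,\ldots,\sigma_n$ and $v$ be weights on $\mathbb{R}^d$. Define $$[ \vec{\sigma},v]_{L_{\vec {\Phi},\Psi}}:=\sup_{Q\in \mathcal Q}\left(\prod_{i=1}^n\Psi\circ\Phi_i^{-1}\left(\frac{1}{\sigma_i(Q)}\right)\right)\left(\int_Q\Psi\left(\mathcal {M}_\alpha(\sigma_1\chi_Q,\ldots,\sigma_n\chi_Q)(x)\right)v(x)\,dx\right).$$ Then $\mathcal{M}_\alpha(\vec{\sigma}\,\cdot)$ is bounded from $L^{\Phi_1}(\sigma_1)\times\cdots\times L^{\Phi_n}(\sigma_n)$ to $L^\Psi(v)$ if $[ \vec{\sigma},v]_{L_{\vec {\Phi},\Psi}}$ is finite. Moreover, $$\|\mathcal M_\alpha(\vec{\sigma}\,\cdot)\|_{\left(\prod_{i=1}^nL^{\Phi_i}(\sigma_i)\right)\rightarrow L^\Psi(v)}\lesssim \Psi^{-1}\left([ \vec{\sigma},v]_{L_{\vec {\Phi},\Psi}}\right).$$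
   Context: $\mathbb{R}_+=[0,\infty)$, $\mathbb{R}_+^*=(0,\infty)$. $\mathcal{Q}$ is the set of non-degenerate cubes in $\mathbb{R}^d$ with sides parallel to the axes; $|Q|$ is Lebesgue measure. A weight is a locally integrable, almost everywhere positive function $\sigma$ on $\mathbb{R}^d$; $\sigma(E)=\int_E\sigma(x)\,dx$. The multilinear fractional maximal function is, for $0\le\alpha<nd$, $$\mathcal{M}_\alpha(f_1,\dots,f_n)(x):=\sup_{Q\in \mathcal{Q}}|Q|^{\alpha /d}\prod_{i=1}^n\frac{\chi_Q(x)}{|Q|}\int_Q|f_i(y)|\,dy ,$$ and $\mathcal{M}_\alpha(\vec\sigma\,\cdot)$ denotes the operator $(f_1,\dots,f_n)\mapsto\mathcal{M}_\alpha(\sigma_1f_1,\dots,\sigma_nf_n)$. A growth function is a function $\Phi:\mathbb{R}_+\to\mathbb{R}_+$, not identically zero, continuous, nondecreasing and onto. It is of upper-type $q>0$ if there is $C_q>0$ with $\Phi(st)\le C_q t^q\Phi(s)$ for all $s>0$, $t\ge 1$. For $q\ge1$, $\mathcal{U}^q$ is the set of growth functions of upper-type $q$ such that $t\mapsto\Phi(t)/t$ is nondecreasing on $\mathbb{R}_+^*$; $\mathcal{U}=\bigcup_{q\ge1}\mathcal{U}^q$. Standing convention: (up to replacing it by an equivalent function) every $\Phi\in\mathcal{U}$ is assumed convex, of class $C^1$, with $\Phi'(t)\approx\Phi(t)/t$ for $t>0$. $\Phi\in\Delta'$: there is $C>0$ with $\Phi(st)\le C\Phi(s)\Phi(t)$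 for all $s,t>0$. $\Phi\in\Delta_2$: there is $K>0$ with $\Phi(2t)\le K\Phi(t)$ for all $t>0$. For a convex growth function $\Phi\in\Delta_2$, $\Phi\in\nabla_2$ means there is $C>0$ with $\int_0^t\frac{\Phi(s)}{s^2}ds\le C\frac{\Phi(t)}{t}$ for all $t>0$. For $q\ge1$, $\widetilde{\mathcal{U}}^q$ is the set of $\Phi\in\mathcal{U}^q\cap\Delta'$ for which there is $C>0$ with $\Phi(s/t)\le C\,\Phi(s)/t^q$ for all $s,t\ge1$; $\widetilde{\mathcal{U}}=\bigcup_{q\ge1}\widetilde{\mathcal{U}}^q$. For $\Phi\in\mathcal{U}$ and a weight $\sigma$, $L^\Phi(\sigma)$ is the set of (classes of) measurable $f:\mathbb{R}^d\to\mathbb{C}$ with $\|f\|_{L^\Phi_\sigma}^{lux}:=\inf\{\lambda>0:\int_{\mathbb{R}^d}\Phi(|f(x)|/\lambda)\sigma(x)dx\le1\}<\infty$. An operator $T:L^{\Phi_1}(\sigma_1)\times\cdots\times L^{\Phi_n}(\sigma_n)\to L^\Psi(v)$ is bounded if there is $C>0$ with $\|T(f_1,\dots,f_n)\|^{lux}_{L^\Psi_v}\le C\prod_{j}\|f_j\|^{lux}_{L^{\Phi_j}_{\sigma_j}}$ for all $f_j\in L^{\Phi_j}(\sigma_j)$; its norm is the infimum of such $C$. $A\lesssim B$ means $A\le cB$ with a constant $c>0$ depending only on $n,d,\alpha,\Psi,\Phi_1,\dots,\Phi_n$ (not on the weights). *)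

(* Defs.v *)
From HB Require Import structures.
From mathcomp Require Import all_boot all_order all_algebra.
From mathcomp Require Import all_classical all_reals all_analysis.
From mathcomp Require Import measurable_realfun complex.

Set Implicit Arguments.
Unset Strict Implicit.
Unset Printing Implicit Defensive.

Import Order.TTheory GRing.Theory Num.Theory.
Import numFieldNormedType.Exports.

Local Open Scope classical_set_scope.
Local Open Scope ring_scope.

Section TuplePower.
Context {disp : measure_display} {T : measurableType disp} {R : realType}.
Variable l : {sigma_finite_measure set T -> \bar R}.

Section Step.
Variables (k : nat) (m : {sigma_finite_measure set (k.-tuple T) -> \bar R}).

Definition tcons (p : T * k.-tuple T) : k.+1.-tuple T := [tuple of p.1 :: p.2].

Lemma measurable_tcons : measurable_fun setT tcons.
Proof. exact: measurable_cons. Qed.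

Definition cons_measure : set (k.+1.-tuple T) -> \bar R :=
  pushforward (l \x m)%E tcons.

Let pf : {measure set (k.+1.-tuple T) -> \bar R} :=
  @measure_function_pushforward__canonical__measure_function_Measure
    _ _ _ _ _ (l \x m)%E tcons measurable_tcons.

HB.instance Definition _ := isMeasure.Build _ _ _ cons_measure
  (measure0 pf) (measure_ge0 pf) (@measure_semi_sigma_additive _ _ _ pf).

Let cons_measure_sigma_finite : sigma_finite setT cons_measure.
Proof.
have /sigma_finiteP[F [TF ndF Foo]] := sigma_finiteT l.
have /sigma_finiteP[G [TG ndG Goo]] := sigma_finiteT m.
pose g (t : k.+1.-tuple T) : T * k.-tuple T := (thead t, [tuple of behead t]).
have mg : measurable_fun setT g.
  by apply: measurable_fun_pair;
    [exact: measurable_tnth | exact: measurable_behead].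
have gK p : g (tcons p) = p.
  by case: p => x t; rewrite /g/=; congr pair; exact: val_inj.
exists (fun i => g @^-1` (F i `*` G i)).
  apply/esym; rewrite -subTset => t _.
  have [i _ Fi] : (\bigcup_k F k) (g t).1 by rewrite -TF.
  have [j _ Gj] : (\bigcup_k G k) (g t).2 by rewrite -TG.
  exists (maxn i j) => //; split.
  - exact: (subsetPset _ _ (ndF _ _ (leq_maxl i j))).
  - exact: (subsetPset _ _ (ndG _ _ (leq_maxr i j))).
move=> i; have [mFi Fi] := Foo i; have [mGi Gi] := Goo i; split.
  by rewrite -[X in measurable X]setTI; apply: mg => //; exact: measurableX.
rewrite /cons_measure /pushforward -comp_preimage.
rewrite (_ : g \o _ = id) ?preimage_id; last by apply/funext => p; exact: gK.
by rewrite product_measure1E// lte_mul_pinfty// ge0_fin_numE.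
Qed.

HB.instance Definition _ :=
  Measure_isSigmaFinite.Build _ _ _ cons_measure cons_measure_sigma_finite.

End Step.

(* The k-fold product measure l \x ... \x l on k.-tuple T. *)
Fixpoint tuple_measure (k : nat) :
    {sigma_finite_measure set (k.-tuple T) -> \bar R} :=
  match k with
  | 0 => \d_([tuple] : 0.-tuple T)
  | k'.+1 => cons_measure (tuple_measure k')
  end.

End TuplePower.

Section Euclidean.
Context (R : realType) (d : nat).

(* R^d with its Lebesgue sigma-algebra, i.e. the Caratheodory completion of the
   Borel one; the i-th coordinate of x is tnth x i. *)
Definition Rd : measurableType _ :=
  caratheodory_type (mu_ext (tuple_measure (@lebesgue_measure R) d)).

Definition leb : {measure set Rd -> \bar R} :=
  @completed_measure_extension _ _ _ (tuple_measure (@lebesgue_measure R) d).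

(* Non-degenerate closed cubes with sides parallel to the axes. *)
Definition cube (a : 'I_d -> R) (s : R) : set Rd :=
  [set x | forall i, a i <= tnth (x : d.-tuple R) i <= a i + s].

Let bcube k (a : 'I_k -> R) (s : R) :
    set (k.-tuple (measurableTypeR R)) :=
  [set x | forall i, a i <= tnth (x : k.-tuple R) i <= a i + s].

Let mbcube k (a : 'I_k -> R) (s : R) : measurable (bcube a s).
Proof.
have -> : bcube a s = \bigcap_(i in [set: 'I_k])
   ((fun x : k.-tuple (measurableTypeR R) => tnth x i) @^-1` `[a i, a i + s]).
  apply/seteqP; split=> x /= h i.
    by move=> _ /=; rewrite in_itv/=; exact: h.
  by have := h i I; rewrite /= in_itv.
apply: fin_bigcap_measurable => // i _; rewrite -[X in measurable X]setTI.
by apply: measurable_tnth => //; exact: measurable_itv.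
Qed.

Let bcubeE k (a : 'I_k -> R) (s : R) : 0 < s ->
  tuple_measure (@lebesgue_measure R) k (bcube a s) = (s ^+ k)%:E.
Proof.
move=> s0; elim: k a => [|k IH] a.
  rewrite /= diracE expr0 mem_set//; by case.
rewrite /= /cons_measure /pushforward.
have -> : @tcons _ (measurableTypeR R) k @^-1` bcube a s =
   `[a ord0, a ord0 + s] `*` bcube (fun i => a (lift ord0 i)) s.
  apply/seteqP; split => -[x t] /=.
    move=> h; split; first by have := h ord0; rewrite in_itv/=.
    by move=> i; have := h (lift ord0 i); rewrite tnthS.
  move=> [h1 h2] i; case: (unliftP ord0 i) => [j ->|->].
    by rewrite tnthS; exact: h2.
  by move: h1; rewrite in_itv.
rewrite product_measure1E//=; last exact: mbcube.
rewrite IH.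
rewrite lebesgue_measure_itv/= lte_fin ltrDl s0 -EFinD addrAC subrr add0r.
by rewrite exprS EFinM.
Qed.

Lemma leb_cube (a : 'I_d -> R) (s : R) : 0 < s ->
  leb (cube a s) = (s ^+ d)%:E.
Proof.
move=> s0; rewrite -(bcubeE a s0).
exact: (@measurable_mu_extE _ _ _ (tuple_measure (@lebesgue_measure R) d)
  _ (mbcube a s)).
Qed.

Definition cubes : set (set Rd) :=
  [set Q | exists a s, 0 < s /\ Q = cube a s].

Definition vol (Q : set Rd) : R := fine (leb Q).

(* d.-tuple R carries no topology in the library: compactness is that of
   'rV[R]_d. *)
Definition locally_integrable_Rd (s : Rd -> R) : Prop :=
  measurable_fun setT s /\
  forall K : set 'rV[R]_d, compact K ->
    leb.-integrable [set x | K (\row_i tnth (x : d.-tuple R) i)] (EFin \o s).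

Definition weight (s : Rd -> R) : Prop :=
  locally_integrable_Rd s /\ {ae leb, forall x, 0 < s x}.

Definition weight_measure (s : Rd -> R) (E : set Rd) : \bar R :=
  (\int[leb]_(x in E) (s x)%:E)%E.

Definition modulus (z : R[i]) : R := ComplexField.Normc.normc z.

Definition maximal (alpha : R) (n : nat) (f : 'I_n -> Rd -> R[i]) (x : Rd) :
    \bar R :=
  ereal_sup [set ((vol Q `^ (alpha / d%:R))%:E *
    \prod_(i < n) ((\1_Q x / vol Q)%:E *
                   \int[leb]_(y in Q) (modulus (f i y))%:E))%E | Q in cubes].

Definition weighted_maximal (alpha : R) (n : nat) (sigma : 'I_n -> Rd -> R)
    (f : 'I_n -> Rd -> R[i]) : Rd -> \bar R :=
  maximal alpha (fun i x => (sigma i x)%:C%C * f i x).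

End Euclidean.

Section GrowthFunctions.
Context (R : realType).
Implicit Types (Phi : R -> R) (q : R).

(* A growth function [0, oo[ -> [0, oo[ is represented by a function on R whose
   values at negative arguments are irrelevant. *)
Definition growth_function Phi : Prop :=
  [/\ forall t : R, 0 <= t -> 0 <= Phi t,
      exists2 t : R, 0 <= t & Phi t != 0,
      {within `[0, +oo[, continuous Phi},
      forall s t : R, 0 <= s -> s <= t -> Phi s <= Phi t &
      set_surj `[0, +oo[ `[0, +oo[ Phi].

Definition upper_type q Phi : Prop :=
  exists2 C : R, 0 < C &
    forall s t : R, 0 < s -> 1 <= t -> Phi (s * t) <= C * t `^ q * Phi s.

Definition nondecreasing_pos (f : R -> R) : Prop :=
  forall s t : R, 0 < s -> s <= t -> f s <= f t.

Definition U_q q Phi : Prop :=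
  [/\ growth_function Phi, upper_type q Phi &
      nondecreasing_pos (fun t => Phi t / t)].

Definition convex_growth Phi : Prop :=
  convex_function (E := R^o) `[0, +oo[ Phi.

Definition U_convention Phi : Prop :=
  [/\ convex_growth Phi,
      forall t : R, 0 < t -> derivable Phi t 1,
      forall t : R, 0 < t -> {for t, continuous (derive1 Phi)} &
      exists c1 c2 : R, [/\ 0 < c1, 0 < c2 &
        forall t : R, 0 < t -> c1 * (Phi t / t) <= derive1 Phi t <= c2 * (Phi t / t)]].

Definition Delta' Phi : Prop :=
  exists2 C : R, 0 < C &
    forall s t : R, 0 < s -> 0 < t -> Phi (s * t) <= C * Phi s * Phi t.

Definition Delta2 Phi : Prop :=
  exists2 K : R, 0 < K & forall t : R, 0 < t -> Phi (2 * t) <= K * Phi t.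

Definition nabla2 Phi : Prop :=
  [/\ growth_function Phi, convex_growth Phi, Delta2 Phi &
      exists2 C : R, 0 < C & forall t : R, 0 < t ->
        (\int[lebesgue_measure]_(s in `]0%R, t[) (Phi s / s ^+ 2)%:E
           <= (C * (Phi t / t))%:E)%E].

Definition Utilde_q q Phi : Prop :=
  [/\ U_q q Phi, Delta' Phi &
      exists2 C : R, 0 < C &
        forall s t : R, 1 <= s -> 1 <= t -> Phi (s / t) <= C * Phi s / t `^ q].

(* Members of U are by convention convex and C^1, with Phi'(t) comparable to
   Phi(t) / t. *)
Definition class_U Phi : Prop :=
  (exists2 q : R, 1 <= q & U_q q Phi) /\ U_convention Phi.

Definition class_Utilde Phi : Prop :=
  (exists2 q : R, 1 <= q & Utilde_q q Phi) /\ U_convention Phi.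

(* Functions of class U are bijections of [0, oo[. *)
Definition growth_inv Phi : R -> R := pinv (`[0, +oo[ : set R) Phi.

End GrowthFunctions.

Section Orlicz.
Context (R : realType) (d : nat).
Implicit Types (Phi : R -> R) (s : Rd R d -> R) (g : Rd R d -> \bar R).
Local Open Scope ereal_scope.

(* The Luxemburg norm of an extended-real-valued function, with Phi(+oo) = +oo
   as given by er_map; its value is +oo when no lambda is admissible. *)
Definition luxemburg Phi s g : \bar R :=
  ereal_inf [set lam%:E | lam in [set lam : R | (0 < lam)%R /\
    \int[leb R d]_x (er_map Phi (`|g x| * (lam^-1)%:E) * (s x)%:E) <= 1]].

Definition luxemburgC Phi s (f : Rd R d -> R[i]) : \bar R :=
  luxemburg Phi s (fun x => (modulus (f x))%:E).

Definition measurable_complex (f : Rd R d -> R[i]) : Prop :=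
  measurable_fun setT (fun x => complex.Re (f x)) /\
  measurable_fun setT (fun x => complex.Im (f x)).

Definition orlicz Phi s (f : Rd R d -> R[i]) : Prop :=
  measurable_complex f /\ luxemburgC Phi s f < +oo.

(* For [0, +oo]-valued functions such as the values of a maximal operator. *)
Definition orlicz_ereal Phi s g : Prop :=
  measurable_fun setT g /\ luxemburg Phi s g < +oo.

Section Operators.
Variables (n : nat) (Phi : 'I_n -> R -> R) (sigma : 'I_n -> Rd R d -> R).
Variables (Psi : R -> R) (v : Rd R d -> R).
Variable T : ('I_n -> Rd R d -> R[i]) -> Rd R d -> \bar R.

Definition op_bound (C : R) : Prop :=
  (0 < C)%R /\
  forall f, (forall j, orlicz (Phi j) (sigma j) (f j)) ->
    luxemburg Psi v (T f) <=
      C%:E * \prod_(j < n) luxemburgC (Phi j) (sigma j) (f j).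

Definition op_bounded : Prop :=
  (forall f, (forall j, orlicz (Phi j) (sigma j) (f j)) ->
     orlicz_ereal Psi v (T f)) /\
  exists C, op_bound C.

Definition op_norm : \bar R := ereal_inf [set C%:E | C in op_bound].

End Operators.

Definition testing_constant (alpha : R) (n : nat) (Phi : 'I_n -> R -> R)
    (Psi : R -> R) (sigma : 'I_n -> Rd R d -> R) (v : Rd R d -> R) : \bar R :=
  ereal_sup [set
    (\prod_(i < n)
       Psi (growth_inv (Phi i) ((fine (weight_measure (sigma i) Q))^-1)))%R%:E *
    \int[leb R d]_(x in Q)
      (er_map Psi
         (maximal alpha (fun i y => (sigma i y * \1_Q y)%:C%C) x) * (v x)%:E)
    | Q in @cubes R d].

End Orlicz.

(* Main.v *)
Require Import Defs.
From mathcomp Require Import all_boot all_order all_algebra.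
From mathcomp Require Import all_classical all_reals all_analysis.
From mathcomp Require Import measurable_realfun complex.
From mathcomp Require Import ring lra zify.

Set Implicit Arguments.
Unset Strict Implicit.
Unset Printing Implicit Defensive.

Import Order.TTheory GRing.Theory Num.Theory.
Import numFieldNormedType.Exports.

Local Open Scope classical_set_scope.
Local Open Scope ring_scope.

(** For [Psi] in the class [class_Utilde] the upper bound [Psi t <= C t^q] and
the decay [Psi (1/t) <= C t^(-q)], both for [t >= 1], carry the same exponent
[q].  Hence [Psi t * Psi (1/t)] is bounded on the whole half-line, and with the
condition [Delta'] this gives [Psi (s/t) <= C Psi s / Psi t]
([Utilde_div_le]).  Write [M f] for
[M_alpha (sigma_1 f_1, ..., sigma_n f_n)].  An estimate of the modular
[\int Psi (M f) v] by the testing constant [K] becomes, after division of [M f] by [c * t] with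
[K <= Psi t], an estimate of the Luxemburg norm by [c * t]; letting [t] decrease
to [Psi^-1 K] yields the bound of the operator norm.

So it is enough to bound [\int Psi (M f) v] by a multiple of [K] when
[\int Phi_j (|f_j|) sigma_j <= 1] for all [j].  Enlarging cubes slightly, the
maximal function is a supremum over countably many rational cubes, and by
monotone convergence a finite maximum [max_first] may be treated.  Each of its
cubes lies in a dyadic cube of comparable size of one of [2^d] grids, obtained
by translating one grid by a third of the top side in some of the coordinates
([cube_sub_dyadic]).  What remains is a finite family of half-open cubes any two
of which are nested or disjoint.

For such a family ([carleson_max_bound]) let the average of [f_j] over [Q] with
respect to [sigma_j] lie between two consecutive powers of 2, and record for
each [j] the level [k_j] of this power together with the largest cube [R_j]
around [Q] on which the average still exceeds that level.  All the cubes [Q]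
with the same record lie in the smallest, [R], of the [R_j], so that on [R]
their maximal function is controlled by the product of the levels times
[M_alpha (sigma chi_R)]: the testing condition bounds the contribution of a
record by [K] times the product over [j] of
[Psi (2^k_j) / Psi (Phi_j^-1 (1 / sigma_j R_j))].  Since [Psi / Phi_j] is
nondecreasing, the [j]-th factor is at most [Phi_j (2^k_j) sigma_j R_j]
([growth_ratio_inv_le]).  Summing over all records, which are families indexed by
[j] of independent choices of [(k_j, R_j)], factors as a product over [j].

Each factor is a sum of [Phi (2^k) sigma R] over the levels [k] and the maximal
cubes [R] of level [k].  There [2^k sigma R] is at most the integral of [f sigma]
over the part of [R] where [f] exceeds [2^k] (up to a constant factor), maximal
cubes of the same level are disjoint, and the condition [nabla2] sums
[Phi (2^k) / 2^k] over [2^k < f] to a multiple of [Phi f / f]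
([nabla2_dyadic_sum]): the factor is at most a multiple of
[\int Phi f sigma <= 1] ([sum_Phi_mass_le]). *)

(** * Growth functions *)

Section GrowthLemmas.
Context {R : realType}.
Implicit Types Phi Psi : R -> R.

(** Common to [Psi] and all the [Phi_j].  Positivity and the monotonicity of the ratio
make the function strictly increasing, so that [growth_inv] is its true inverse. *)
Record growth_pos Phi : Prop := GrowthPos {
  gp_growth : growth_function Phi;
  gp_pos : forall t, 0 < t -> 0 < Phi t;
  gp_ratio : nondecreasing_pos (fun t => Phi t / t) }.

(** A zero at some [t > 0] would spread to all larger arguments by the upper type,
and to all smaller ones by monotonicity. *)
Lemma U_q_growth_pos Phi q : U_q q Phi -> growth_pos Phi.
Proof.
move=> [gP [C C0 hC] rP]; split => // t t0.
have [P0 [s s0 Ps] _ ndP _] := gP.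
rewrite lt_neqAle P0 ?ltW// andbT; apply/eqP => Pt0.
have [st|ts] := leP s t.
  have := ndP _ _ s0 st; rewrite -Pt0 => Ps0.
  by move/eqP: Ps; apply; apply/eqP; rewrite eq_le Ps0 P0.
have := hC t (s / t) t0; rewrite ler_pdivlMr// mul1r (ltW ts) => /(_ isT).
rewrite mulrCA divff ?gt_eqF// mulr1 -Pt0 mulr0 => Ps0.
by move/eqP: Ps; apply; apply/eqP; rewrite eq_le Ps0 P0.
Qed.

Section GrowthPosTheory.
Variables (Phi : R -> R) (gP : growth_pos Phi).

Lemma growth_ge0 t : 0 <= t -> 0 <= Phi t.
Proof. by have [[+ _ _ _ _] _ _] := gP; exact. Qed.

Lemma growth_le s t : 0 <= s -> s <= t -> Phi s <= Phi t.
Proof. by have [[_ _ _ + _] _ _] := gP; exact. Qed.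

Lemma growth_invK y : 0 <= y -> Phi (growth_inv Phi y) = y.
Proof.
have [[_ _ _ _ sP] _ _] := gP => y0; rewrite /growth_inv (surjpK _ sP)//.
by rewrite inE /= in_itv /= y0.
Qed.

Lemma growth_inv_ge0 y : 0 <= y -> 0 <= growth_inv Phi y.
Proof.
have [[_ _ _ _ sP] _ _] := gP => y0.
have /(_ (growth_inv Phi y)) := surjpinv_image_sub (dflt := fun=> point) sP.
rewrite /= in_itv /= andbT; apply.
by exists y => //; rewrite in_itv /= y0.
Qed.

Lemma growth0 : Phi 0 = 0.
Proof.
have [[_ _ _ _ sP] _ _] := gP.
have /sP[t /=] : `[0, +oo[%classic (0 : R) by rewrite /= in_itv /= lexx.
rewrite in_itv /= andbT => t0 Pt.
by apply/eqP; rewrite eq_le (growth_ge0 (lexx _)) andbT -{2}Pt growth_le.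
Qed.

Lemma growth_ratio_le s t : 0 < s -> s <= t -> Phi s / s * t <= Phi t.
Proof.
move=> s0 st; have t0 := lt_le_trans s0 st.
by rewrite -ler_pdivlMr//; exact: (gp_ratio gP).
Qed.

Lemma growth_lt s t : 0 <= s -> s < t -> Phi s < Phi t.
Proof.
rewrite le_eqVlt => /predU1P[<-|s0] st; first by rewrite growth0 gp_pos.
apply: lt_le_trans (growth_ratio_le s0 (ltW st)).
by rewrite mulrAC -mulrA ltr_pMr ?gp_pos// ltr_pdivlMr// mul1r.
Qed.

Lemma growth_inv_gt0 y : 0 < y -> 0 < growth_inv Phi y.
Proof.
move=> y0; rewrite lt_neqAle growth_inv_ge0 ?ltW// andbT; apply/eqP => i0.
by move: (growth_invK (ltW y0)); rewrite -i0 growth0 => /eqP; rewrite lt_eqF.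
Qed.

Lemma le_growth_inv u y : 0 <= y -> Phi u <= y -> u <= growth_inv Phi y.
Proof.
move=> y0 uy; rewrite leNgt; apply/negP => /(growth_lt (growth_inv_ge0 y0)).
by rewrite growth_invK// ltNge uy.
Qed.

Lemma growth_inv_le y z : 0 <= y -> y <= z ->
  growth_inv Phi y <= growth_inv Phi z.
Proof.
by move=> y0 yz; apply: le_growth_inv; rewrite ?growth_invK// (le_trans y0).
Qed.

Lemma growth_div_le c t : 1 <= c -> 0 <= t -> Phi (t / c) <= Phi t / c.
Proof.
move=> c1; rewrite le_eqVlt => /predU1P[<-|t0]; first by rewrite !mul0r growth0 mul0r.
have c0 : 0 < c by rewrite (lt_le_trans _ c1).
have tc : t / c <= t by rewrite ler_pdivrMr// ler_peMr// ltW.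
have := growth_ratio_le (divr_gt0 t0 c0) tc.
by rewrite invf_div -mulrA divfK ?gt_eqF// -ler_pdivlMr.
Qed.

End GrowthPosTheory.

(** For [t >= 1] the factors [t^q] and [t^-q] cancel, because both conditions hold
with the same exponent; the case [t < 1] is symmetric. *)
Lemma Utilde_recip_le Psi q : Utilde_q q Psi ->
  exists2 C, 0 < C & forall t, 0 < t -> Psi t * Psi t^-1 <= C.
Proof.
move=> [U _ [B B0 hB]]; have gP := U_q_growth_pos U.
have [_ [A A0 hA] _] := U; have P1 := gp_pos gP (@ltr01 R).
exists (A * Psi 1 * (B * Psi 1)); first by rewrite !mulr_gt0.
have main t : 1 <= t -> Psi t * Psi t^-1 <= A * Psi 1 * (B * Psi 1).
  move=> t1; have t0 : 0 < t by rewrite (lt_le_trans _ t1).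
  have q0 : 0 < t `^ q by rewrite powR_gt0.
  have := hA 1 t ltr01 t1; rewrite mul1r => ht.
  have := hB 1 t (lexx _) t1; rewrite mul1r => hit.
  have p1 : 0 <= Psi t by apply/ltW/(gp_pos gP).
  have p2 : 0 <= Psi t^-1 by apply/ltW/(gp_pos gP); rewrite invr_gt0.
  apply: le_trans (ler_pM p1 p2 ht hit) _; rewrite le_eqVlt; apply/orP; left.
  by apply/eqP; field; rewrite gt_eqF.
move=> t t0; have [/main//|t1] := leP 1 t.
by rewrite mulrC -{2}(invrK t) main// invf_ge1// ltW.
Qed.

Lemma Delta'_ge0 Psi : growth_pos Psi -> Delta' Psi ->
  exists2 C, 1 <= C & forall s t, 0 <= s -> 0 <= t ->
    Psi (s * t) <= C * Psi s * Psi t.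
Proof.
move=> gP [C C0 hC]; have C1 : C <= Num.max C 1 by rewrite le_max lexx.
exists (Num.max C 1) => [|s t s0 t0]; first by rewrite le_max lexx orbT.
have Cm : 0 <= Num.max C 1 by exact: le_trans (ltW C0) C1.
move: (s0); rewrite le_eqVlt => /predU1P[<-|sgt0].
  by rewrite mul0r growth0// mulr0 mul0r.
move: (t0); rewrite le_eqVlt => /predU1P[<-|tgt0].
  by rewrite mulr0 growth0// mulr0.
apply: le_trans (hC _ _ sgt0 tgt0) _.
by rewrite !ler_wpM2r ?(growth_ge0 gP).
Qed.

Lemma Delta'_prod Psi C : growth_pos Psi -> 1 <= C ->
  (forall s t, 0 <= s -> 0 <= t -> Psi (s * t) <= C * Psi s * Psi t) ->
  forall (n : nat) (a : R) (u : 'I_n -> R), 0 <= a -> (forall j, 0 <= u j) ->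
    Psi (a * \prod_j u j) <= C ^+ n * Psi a * \prod_j Psi (u j).
Proof.
move=> gP C1 hC; have C0 : 0 <= C by rewrite (le_trans _ C1).
elim=> [|n IH] a u a0 u0; first by rewrite !big_ord0 !mulr1 mul1r.
rewrite !big_ord_recl mulrA.
apply: le_trans (IH (a * u ord0) (fun j => u (lift ord0 j)) _ _) _ => //.
  by rewrite mulr_ge0.
rewrite [leRHS]mulrA ler_wpM2r ?prodr_ge0//.
  by move=> j _; exact: growth_ge0.
rewrite exprSr -!mulrA ler_wpM2l ?exprn_ge0//.
by rewrite mulrA hC.
Qed.

(** This is [Psi s * Psi t^-1 <= C Psi s / Psi t], obtained from [Delta'] and the
boundedness of [Psi t * Psi t^-1]. *)
Lemma Utilde_div_le Psi q : Utilde_q q Psi ->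
  exists2 C, 0 < C & forall s t, 0 <= s -> 0 < t -> Psi (s / t) <= C * Psi s / Psi t.
Proof.
move=> Ut; have [U D _] := Ut; have gP := U_q_growth_pos U.
have [A A1 hA] := Delta'_ge0 gP D; have [B B0 hB] := Utilde_recip_le Ut.
have A0 : 0 < A by rewrite (lt_le_trans _ A1).
exists (A * B) => [|s t s0 t0]; first exact: mulr_gt0.
have Pt := gp_pos gP t0.
apply: le_trans (hA _ _ s0 _) _; first by rewrite invr_ge0 ltW.
rewrite ler_pdivlMr// [leLHS](_ : _ = A * Psi s * (Psi t * Psi t^-1)); last by ring.
rewrite [leRHS]mulrAC; apply: ler_wpM2l; last exact: hB.
by rewrite mulr_ge0 ?(growth_ge0 gP)// ltW.
Qed.

(** Truncating the argument at 0 makes the function monotone on the whole line;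
its values at negative arguments are arbitrary. *)
Lemma growth_measurable Phi : growth_pos Phi ->
  measurable_fun setT (fun t : R => Phi (Num.max 0 t)).
Proof.
move=> gP; apply: nondecreasing_measurable => // s t st.
apply: (growth_le gP); first by rewrite le_max lexx.
by rewrite ge_max !le_max lexx st orbT.
Qed.

Lemma measurable_growth_sqr Phi : growth_pos Phi ->
  measurable_fun (`]0%R, +oo[ : set R) (fun s : R => (Phi s / s ^+ 2)%:E).
Proof.
move=> gP; apply/measurable_EFinP.
apply: (@eq_measurable_fun _ _ _ _ _ ((fun s => Phi (Num.max 0 s)) \* (fun s => (s ^+ 2)^-1))).
  move=> s; rewrite inE /= in_itv /= andbT => s0 /=.
  by rewrite (max_idPr (ltW s0)).
apply: measurable_funM.
  by apply: measurable_funS (growth_measurable gP).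
apply: open_continuous_measurable_fun; first exact: interval_open.
move=> s; rewrite inE /= in_itv /= andbT => s0.
apply: cvgV; first by rewrite expf_neq0 ?gt_eqF.
exact: exprn_continuous.
Qed.

(** On [[l, 2l)] the numerator is at least [Phi l] and the denominator at most
[4 l^2]. *)
Lemma dyadic_interval_integral Phi (l : R) : growth_pos Phi -> 0 < l ->
  ((Phi l / l / 4)%:E <=
   \int[lebesgue_measure]_(s in `[l, (2 * l)%R[) (Phi s / s ^+ 2)%:E)%E.
Proof.
move=> gP l0; have l2 : l < 2 * l by lra.
have mI : measurable (`[l, (2 * l)%R[ : set R) by exact: measurable_itv.
apply: (@le_trans _ _ (\int[lebesgue_measure]_(s in `[l, (2 * l)%R[)
    (cst (Phi l / (4 * l ^+ 2))%:E) s)%E).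
  rewrite integral_cst//= lebesgue_measure_itv/= lte_fin l2 -EFinD -EFinM lee_fin.
  rewrite le_eqVlt; apply/orP; left; apply/eqP; field; lra.
apply: ge0_le_integral => //.
- by move=> s _; rewrite lee_fin divr_ge0 ?(growth_ge0 gP) ?mulr_ge0 ?exprn_ge0 ?ltW.
- apply: measurable_funS (measurable_growth_sqr gP) => //.
  by move=> s /=; rewrite !in_itv /= andbT => /andP[ls _]; exact: lt_le_trans ls.
- move=> s; rewrite /= in_itv /= => /andP[ls sl]; have s0 := lt_le_trans l0 ls.
  rewrite lee_fin; apply: ler_pM.
  + exact/(growth_ge0 gP)/ltW.
  + by rewrite invr_ge0 mulr_ge0// exprn_ge0// ltW.
  + exact: (growth_le gP (ltW l0)).
  rewrite lef_pV2 ?posrE ?mulr_gt0 ?exprn_gt0//.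
  rewrite (_ : 4 * l ^+ 2 = (2 * l) ^+ 2); last by ring.
  by rewrite lerXn2r ?nnegrE ?(ltW s0) ?(ltW sl)// mulr_ge0// ltW.
Qed.

Lemma dyadic_sum_integral Phi (l : R) (M : nat) : growth_pos Phi -> 0 < l ->
  ((\sum_(k < M) Phi (l * 2 ^+ k) / (l * 2 ^+ k) / 4)%:E <=
   \int[lebesgue_measure]_(s in `]0%R, (l * 2 ^+ M)%R[) (Phi s / s ^+ 2)%:E)%E.
Proof.
move=> gP l0.
have nneg (D : set R) (s : R) : D `<=` `]0%R, +oo[ -> D s -> (0 <= (Phi s / s ^+ 2)%:E)%E.
  move=> DD /DD; rewrite /= in_itv /= andbT => s0.
  by rewrite lee_fin divr_ge0 ?(growth_ge0 gP) ?exprn_ge0 ?ltW.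
elim: M => [|M IH].
  rewrite big_ord0; apply: integral_ge0 => s; apply: nneg => t /=.
  by rewrite !in_itv /= => /andP[->].
have lM : 0 < l * 2 ^+ M by rewrite mulr_gt0// exprn_gt0.
have lMS : l * 2 ^+ M.+1 = 2 * (l * 2 ^+ M) by rewrite exprS mulrCA.
have subD : `]0%R, (l * 2 ^+ M.+1)%R[ `<=` (`]0%R, +oo[ : set R).
  by move=> t /=; rewrite !in_itv /= => /andP[->].
have -> : `]0%R, (l * 2 ^+ M.+1)%R[%classic =
    `]0%R, (l * 2 ^+ M)%R[%classic `|` `[(l * 2 ^+ M)%R, (l * 2 ^+ M.+1)%R[%classic.
  apply: itv_bndbnd_setU; rewrite bnd_simp//.
  by rewrite lMS; lra.
have subU : `]0%R, (l * 2 ^+ M)%R[%classic `|` `[(l * 2 ^+ M)%R, (l * 2 ^+ M.+1)%R[%classic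
    `<=` (`]0%R, +oo[ : set R).
  move=> t /= []; rewrite !in_itv /= andbT => /andP[h _] //.
  exact: lt_le_trans h.
rewrite ge0_integral_setU//=.
- rewrite big_ord_recr /= EFinD; apply: leeD => //.
  by rewrite lMS; exact: dyadic_interval_integral.
- by apply: measurable_funS (measurable_growth_sqr gP).
- by move=> s Ds; exact: (nneg _ _ subU Ds).
- rewrite disj_set2E; apply/eqP/seteqP; split=> // s /= [].
  by rewrite !in_itv /= => /andP[_ h1] /andP[/(lt_le_trans h1)]; rewrite ltxx.
Qed.

(** The form in which [nabla2] is used.  The base [l] is free so that the levels can
be placed below all the averages of a finite family, which leaves finitely many
[k]. *)
Definition dyadic_sums_le Phi (C : R) : Prop :=
  forall (l t : R) (M : nat), 0 < l -> 0 < t ->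
    \sum_(k < M | l * 2 ^+ k < t) Phi (l * 2 ^+ k) / (l * 2 ^+ k) <= C * (Phi t / t).

(** The dyadic intervals up to [l 2^M] are disjoint, so the full sum is at most
[4 \int_0^(l 2^M) Phi s / s^2]; if all the terms are present then
[l 2^M <= 2 t], and [Delta2] brings the bound back to [t]. *)
Lemma nabla2_dyadic_sum Phi : growth_pos Phi -> nabla2 Phi ->
  exists2 C, 0 < C & dyadic_sums_le Phi C.
Proof.
move=> gP [_ _ [K K0 hK] [C C0 hC]].
exists (2 * C * K) => [|l t M l0 t0]; first by rewrite !mulr_gt0.
have term0 (k : nat) : 0 <= Phi (l * 2 ^+ k) / (l * 2 ^+ k).
  have h : 0 <= l * 2 ^+ k by rewrite mulr_ge0 ?exprn_ge0// ltW.
  by rewrite divr_ge0// (growth_ge0 gP).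
elim: M => [|M IH].
  by rewrite big_ord0 mulr_ge0 ?divr_ge0 ?(growth_ge0 gP) ?mulr_ge0// ?ltW.
rewrite big_mkcond big_ord_recr -big_mkcond /=.
(* The levels increase: if the last one is below t, all of them are. *)
case: ifP => lt; last by rewrite addr0.
have lM : 0 < l * 2 ^+ M.+1 by rewrite mulr_gt0// exprn_gt0.
apply: (@le_trans _ _ (\sum_(k < M.+1) Phi (l * 2 ^+ k) / (l * 2 ^+ k))).
  rewrite big_ord_recr /= lerD2r [leRHS](bigID (fun k : 'I_M => l * 2 ^+ k < t))/=.
  by rewrite lerDl sumr_ge0.
have := le_trans (dyadic_sum_integral M.+1 gP l0) (hC _ lM).
rewrite lee_fin -mulr_suml ler_pdivrMr// => /le_trans; apply.
have l2t : l * 2 ^+ M.+1 <= 2 * t by rewrite exprS mulrCA ler_pM2l// ltW.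
have := gp_ratio gP lM l2t; have := hK _ t0.
rewrite !ler_pdivlMr ?mulr_gt0// => h1 h2.
have h3 : Phi (l * 2 ^+ M.+1) / (l * 2 ^+ M.+1) <= K * Phi t / (2 * t).
  by rewrite ler_pdivlMr ?mulr_gt0//; exact: le_trans h1.
rewrite [leRHS](_ : _ = C * (K * Phi t / (2 * t)) * 4); last by field; lra.
by rewrite ler_pM2r// ler_pM2l.
Qed.

End GrowthLemmas.

(** * Finite maxima, levels and finite sums of integrals *)

Section Tools.
Context {R : realType}.

(** Places finitely many numbers on a common dyadic scale, starting below the
smallest positive one. *)
Lemma level_pick (J : finType) (m : J -> R) :
  exists (l : R) (M : nat), 0 < l /\ forall a, 0 < m a ->
    exists k : 'I_M, l * 2 ^+ k < m a <= 2 * (l * 2 ^+ k).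
Proof.
(* The inverse of 0 is 0, so the vanishing m a contribute nothing to this sum. *)
pose l := (1 + \sum_a `|(m a)^-1|)^-1.
have s0 : 0 <= \sum_a `|(m a)^-1| by rewrite sumr_ge0.
have l0 : 0 < l by rewrite invr_gt0; lra.
pose M := (Num.truncn (\sum_a `|m a| / l)).+1.
exists l, M; split => // a ma0.
have lm : l < m a.
  rewrite -[m a]invrK ltf_pV2 ?posrE ?invr_gt0//; last lra.
  rewrite (bigD1 a)//= ger0_norm ?invr_ge0 ?ltW//.
  by rewrite addrCA ltrDl ltr_pwDl// sumr_ge0.
have mM : m a <= l * 2 ^+ M.
  rewrite mulrC -ler_pdivrMr//.
  apply: (@le_trans _ _ (\sum_a `|m a| / l)).
    rewrite (bigD1 a)//= ger0_norm ?(ltW ma0)// lerDl sumr_ge0// => b _.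
    by rewrite divr_ge0// ltW.
  apply: ltW; apply: lt_le_trans (truncnS_gt _) _.
  by rewrite -natrX ler_nat ltnW// ltn_expl.
elim: M mM => [|M IH] mM.
  by rewrite expr0 mulr1 leNgt lm in mM.
have [/IH[k hk]|h] := leP (m a) (l * 2 ^+ M).
  by exists (widen_ord (leqnSn M) k).
by exists ord_max; rewrite h/= mulrCA -exprS.
Qed.

Context {d} {T : measurableType d}.

Lemma measurable_growth_comp (Psi : R -> R) (f : T -> R) : growth_pos Psi ->
  (forall x, 0 <= f x) -> measurable_fun setT f ->
  measurable_fun setT (fun x => Psi (f x)).
Proof.
move=> gP f0 mf; have := measurableT_comp (growth_measurable gP) mf.
by apply: eq_measurable_fun => x _ /=; rewrite (max_idPr (f0 x)).
Qed.

Lemma measurable_bigmaxr (J : Type) (s : seq J) (P : pred J) (f : J -> T -> R) :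
  (forall i, measurable_fun setT (f i)) ->
  measurable_fun setT (fun x => \big[Num.max/0]_(i <- s | P i) f i x).
Proof.
move=> mf; elim: s => [|i s IH].
  by under eq_fun do rewrite big_nil; exact: measurable_cst.
under eq_fun do rewrite big_cons; case: (P i) => //.
exact: (measurable_maxr (mf i) IH).
Qed.

Lemma emeasurable_sum_cond (J : Type) (s : seq J) (P : pred J) (f : J -> T -> \bar R) :
  (forall i, measurable_fun setT (f i)) ->
  measurable_fun setT (fun x => \sum_(i <- s | P i) f i x)%E.
Proof.
move=> mf; under eq_fun do rewrite -big_filter.
exact: emeasurable_sum.
Qed.

Lemma bigmaxr_attained (J : finType) (P : pred J) (f : J -> R) :
  \big[Num.max/0]_(i | P i) f i = 0 \/
  exists2 i, P i & \big[Num.max/0]_(i | P i) f i = f i.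
Proof.
elim/big_ind : _ => [|x y [->|[i Pi ->]] [->|[j Pj ->]]|i Pi]; first by left.
- by left; rewrite maxxx.
- by case: (leP 0 (f j)) => _; [right; exists j|left].
- by case: (leP (f i) 0) => _; [left|right; exists i].
- by right; case: (leP (f i) (f j)) => _; [exists j|exists i].
- by right; exists i.
Qed.

Variable mu : {measure set T -> \bar R}.

Lemma integral_indicl (D : set T) (f : T -> R) :
  (\int[mu]_(x in D) (f x)%:E = \int[mu]_x (\1_D x * f x)%:E)%E.
Proof.
rewrite integral_mkcond; apply: eq_integral => x _.
by rewrite patchE indicE; case: ifP; rewrite (mul1r, mul0r).
Qed.

Lemma ge0_integral_sum_cond (J : Type) (s : seq J) (P : pred J)
    (f : J -> T -> \bar R) :
  (forall i, measurable_fun setT (f i)) -> (forall i x, 0 <= f i x)%E ->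
  (\int[mu]_x (\sum_(i <- s | P i) f i x) = \sum_(i <- s | P i) \int[mu]_x f i x)%E.
Proof.
move=> mf f0; under eq_integral do rewrite -big_filter.
by rewrite ge0_integral_sum// big_filter.
Qed.

End Tools.

(** * Maximal cubes above a level *)

Section Stopping.
Context {R : realType} {d} {T : measurableType d} (mu : {measure set T -> \bar R}).
Context {I : finType} (Q : I -> set T).
Hypotheses (mQ : forall i, measurable (Q i)) (Qinj : injective Q).
Hypothesis nested : forall i j x, Q i x -> Q j x -> Q i `<=` Q j \/ Q j `<=` Q i.

(** Maximality is among the cubes of the family on which the average [A / S]
exceeds [l]. *)
Definition maximal_above (S A : I -> R) (l : R) (i : I) : Prop :=
  l * S i < A i /\ forall j, Q i `<=` Q j -> l * S j < A j -> j = i.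

(** Among the sets containing [Q i] with average above [l], take one that contains
the largest number of members of the family. *)
Lemma maximal_above_exists (S A : I -> R) (l : R) (i : I) : l * S i < A i ->
  exists2 r, Q i `<=` Q r & maximal_above S A l r.
Proof.
move=> Ai.
pose h r := #|[pred k | `[< Q k `<=` Q r >]]|.
pose P r := `[< Q i `<=` Q r >] && (l * S r < A r).
have Pi : P i by rewrite /P Ai andbT; exact/asboolP.
case: (arg_maxnP h Pi) => r /andP[/asboolP ir Ar] rmax.
exists r => //; split => // j rj Aj.
have Pj : P j by rewrite /P Aj andbT; apply/asboolP; exact: subset_trans rj.
have sub : [pred k | `[< Q k `<=` Q r >]] \subset [pred k | `[< Q k `<=` Q j >]].
  apply/fintype.subsetP => k; rewrite !inE => kr.
  exact: (subset_trans kr rj).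
have /subset_cardP/(_ sub)/(_ j) : #|[pred k | `[< Q k `<=` Q r >]]| =
    #|[pred k | `[< Q k `<=` Q j >]]|.
  by apply/eqP; rewrite eqn_leq subset_leq_card//=; exact: rmax.
rewrite !inE => jrE; apply: Qinj; apply/seteqP; split=> //.
have /asboolP := subset_refl (A := Q j).
by rewrite -jrE => /asboolP.
Qed.

(** Two maximal sets with a common point are nested, hence equal. *)
Lemma maximal_above_indic_le1 (S A : I -> R) (l : R) (x : T) :
  \sum_(i | `[< maximal_above S A l i >]) \1_(Q i) x <= 1 :> R.
Proof.
have [/existsP[i /andP[Mi xi]]|] :=
    boolP [exists i, `[< maximal_above S A l i >] && (x \in Q i)]; last first.
  rewrite negb_exists => /forallP none; rewrite big1// => i Mi.
  by have := none i; rewrite Mi/= indicE => /negbTE ->.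
rewrite (bigD1 i)//= big1 ?addr0 ?indicE ?xi// => j /andP[Mj ji].
rewrite indicE; case: (boolP (x \in Q j)) => // xj.
move: Mi Mj ji xi xj => /asboolP[Ai mi] /asboolP[Aj mj] ji; rewrite !inE => xi xj.
have [ij|ij] := nested xi xj.
  by rewrite (mi _ ij Aj) eqxx in ji.
by rewrite (mj _ ij Ai) eqxx in ji.
Qed.

Section OneFunction.
Variables (Phi : R -> R) (gP : growth_pos Phi).
Variables (w F : T -> R) (S A : I -> R).
Hypotheses (mw : measurable_fun setT w) (w0 : forall x, 0 <= w x).
Hypotheses (mF : measurable_fun setT F) (F0 : forall x, 0 <= F x).
Hypothesis (SE : forall i, (\int[mu]_(x in Q i) (w x)%:E = (S i)%:E)%E).
Hypothesis (AE : forall i, (\int[mu]_(x in Q i) (F x * w x)%:E = (A i)%:E)%E).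
Hypothesis (PhiF : (\int[mu]_x (Phi (F x) * w x)%:E <= 1)%E).

Let tail (m : R) (x : T) : R := (m < F x)%R%:R * (F x * w x).

Let measurable_tail m (D : set T) : measurable_fun D (tail m).
Proof.
apply: (@measurable_funS _ _ _ _ setT) => //.
apply: measurable_funM; last exact: measurable_funM.
rewrite (_ : (fun x => (m < F x)%R%:R) = \1_[set x | m < F x]); last first.
  apply/funext => x; rewrite indicE; congr (_%:R); congr nat_of_bool.
  by apply/idP/idP; rewrite inE.
apply: measurable_indic.
have := measurable_fun_ltr (@measurable_cst _ _ _ _ setT m) mF.
move=> /(_ measurableT [set true] Logic.I); rewrite setTI.
by congr measurable; apply/seteqP; split.
Qed.

Let tail_ge0 m x : 0 <= tail m x.
Proof. by rewrite !mulr_ge0. Qed.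

Let PhiF_ge0 x : 0 <= Phi (F x) * w x.
Proof. by rewrite mulr_ge0// (growth_ge0 gP). Qed.

Let mPhiF : measurable_fun setT (fun x => Phi (F x) * w x).
Proof.
by apply: measurable_funM => //; exact: measurable_growth_comp.
Qed.

(** The part of the density below [m] contributes at most [m S] to the integral
[A > 2 m S], so the part above [m] contributes at least [m S]. *)
Lemma mass_le_tail (m : R) (i : I) : 0 < m -> 2 * m * S i < A i ->
  ((m * S i)%:E <= \int[mu]_(x in Q i) (tail m x)%:E)%E.
Proof.
move=> m0 mA.
have mw' : measurable_fun (Q i) (fun x => (m * w x)%:E).
  by apply/measurable_EFinP; apply: measurable_funM => //; exact: measurable_funTS.
have mt' : measurable_fun (Q i) (fun x => (tail m x)%:E).
  by apply/measurable_EFinP.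
have h : (\int[mu]_(x in Q i) (F x * w x)%:E <=
    (m * S i)%:E + \int[mu]_(x in Q i) (tail m x)%:E)%E.
  have -> : ((m * S i)%:E = \int[mu]_(x in Q i) (m * w x)%:E)%E.
    rewrite EFinM -SE; under [RHS]eq_integral do rewrite EFinM.
    rewrite ge0_integralZl//.
    - by apply/measurable_EFinP; exact: measurable_funTS.
    - by move=> x _; rewrite lee_fin.
    - by rewrite lee_fin ltW.
  rewrite -ge0_integralD//; first last.
  - by move=> x _; rewrite lee_fin.
  - by move=> x _; rewrite lee_fin mulr_ge0// ltW.
  apply: ge0_le_integral => //.
  - by move=> x _; rewrite lee_fin mulr_ge0.
  - by apply/measurable_EFinP; exact/measurable_funTS/measurable_funM.
  - exact: emeasurable_funD.
  move=> x _; rewrite -EFinD lee_fin /tail.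
  have [mF'|Fm] := ltP m (F x); first by rewrite mul1r lerDr mulr_ge0// ltW.
  by rewrite mul0r addr0 ler_wpM2r.
have : (0 <= \int[mu]_(x in Q i) (tail m x)%:E)%E.
  by apply: integral_ge0 => x _; rewrite lee_fin.
move: h; rewrite AE; case: (\int[mu]_(x in Q i) _)%E => [t| |] //.
  by rewrite -EFinD !lee_fin; nra.
by move=> _ _; rewrite leey.
Qed.

Lemma tail_le_Phi m x : 0 < m -> Phi m / m * tail m x <= Phi (F x) * w x.
Proof.
move=> m0; rewrite /tail; have [mF'|_] := ltP m (F x); last first.
  by rewrite mul0r mulr0 mulr_ge0 ?(growth_ge0 gP).
by rewrite mul1r mulrA ler_wpM2r// (growth_ratio_le gP)// ltW.
Qed.

Lemma Phi_mass_le (m : R) (i : I) : 0 < m -> 2 * m * S i < A i ->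
  ((Phi m * S i)%:E <= \int[mu]_(x in Q i) (Phi m / m * tail m x)%:E)%E.
Proof.
move=> m0 mA.
have c0 : 0 <= Phi m / m by rewrite divr_ge0 ?(growth_ge0 gP) ?(ltW m0).
under eq_integral do rewrite EFinM.
rewrite ge0_integralZl//=.
- rewrite (_ : Phi m * S i = Phi m / m * (m * S i)); last by field; rewrite gt_eqF.
  by rewrite EFinM lee_wpmul2l ?lee_fin//; exact: mass_le_tail.
- by apply/measurable_EFinP.
- by move=> x _; rewrite lee_fin.
Qed.

(** Says that the level [m] lies below [Phi^-1 (1 / S i)], the range in which
[growth_ratio_inv_le] compares [Psi] with [Phi]. *)
Lemma Phi_mass_le1 (m : R) (i : I) : 0 < m -> 2 * m * S i < A i ->
  Phi m * S i <= 1.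
Proof.
move=> m0 mA; rewrite -lee_fin; apply: le_trans PhiF.
apply: le_trans (Phi_mass_le m0 mA) _.
have c0 : 0 <= Phi m / m by rewrite divr_ge0 ?(growth_ge0 gP) ?(ltW m0).
apply: (@le_trans _ _ (\int[mu]_(x in Q i) (Phi (F x) * w x)%:E)%E).
  apply: ge0_le_integral => //.
  - by move=> x _; rewrite lee_fin mulr_ge0.
  - by apply/measurable_EFinP; apply: measurable_funM.
  - by apply/measurable_EFinP; exact: measurable_funTS.
  - by move=> x _; rewrite lee_fin tail_le_Phi.
apply: ge0_subset_integral => //; first exact/measurable_EFinP.
by move=> x _; rewrite lee_fin.
Qed.

(** After [Phi_mass_le] all the terms are integrals over the whole space.  At a
fixed point at most one maximal set of each level counts, and only the levels
below [F x]; their sum is the one bounded by [dyadic_sums_le]. *)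
Lemma sum_Phi_mass_le (C l : R) (M : nat) : 0 < C -> 0 < l ->
  dyadic_sums_le Phi C ->
  \sum_(k < M) \sum_(i | `[< maximal_above S A (2 * (l * 2 ^+ k)) i >])
     Phi (l * 2 ^+ k) * S i <= C.
Proof.
move=> C0 l0 hC; pose m (k : nat) := l * 2 ^+ k.
have m0 k : 0 < m k by rewrite mulr_gt0// exprn_gt0.
pose c k := Phi (m k) / m k.
have c0 k : 0 <= c k by rewrite divr_ge0 ?(growth_ge0 gP) ?(ltW (m0 k)).
pose g (k : 'I_M) i x := \1_(Q i) x * (c k * tail (m k) x).
have g0 k i x : 0 <= g k i x by rewrite /g mulr_ge0// mulr_ge0.
have mg k i : measurable_fun setT (fun x => (g k i x)%:E).
  apply/measurable_EFinP; apply: measurable_funM; first exact: measurable_indic.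
  exact: measurable_funM.
apply: (@le_trans _ _ (fine C%:E)) => //; rewrite -lee_fin /=.
apply: (@le_trans _ _ (\int[mu]_x (C%:E * (Phi (F x) * w x)%:E))%E); last first.
  rewrite ge0_integralZl//.
  - by rewrite -[leRHS]mule1 lee_wpmul2l// lee_fin ltW.
  - exact/measurable_EFinP.
  - by move=> x _; rewrite lee_fin.
  - by rewrite lee_fin ltW.
apply: (@le_trans _ _ (\int[mu]_x (\sum_(k < M)
   \sum_(i | `[< maximal_above S A (2 * m k) i >]) (g k i x)%:E))%E).
  rewrite ge0_integral_sum//; last 2 first.
  - by move=> k; apply: emeasurable_sum_cond.
  - by move=> k x _; apply: sume_ge0 => i _; rewrite lee_fin.
  rewrite -sumEFin; apply: lee_sum => k _.
  rewrite ge0_integral_sum_cond//; last by move=> i x; rewrite lee_fin.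
  rewrite -sumEFin; apply: lee_sum => i /asboolP[Ai _].
  by rewrite -integral_indicl; apply: Phi_mass_le; first exact: (m0 k).
apply: ge0_le_integral => //.
- by move=> x _; apply: sume_ge0 => k _; apply: sume_ge0 => i _; rewrite lee_fin.
- by apply: emeasurable_sum => k; apply: emeasurable_sum_cond.
- by apply: emeasurable_funM => //; exact/measurable_EFinP.
move=> x _; rewrite -EFinM; under eq_bigr do rewrite sumEFin.
rewrite sumEFin lee_fin.
have [F00|Fx0] := leP (F x) 0.
  rewrite big1; first by rewrite mulr_ge0// ltW.
  move=> k _; rewrite big1// => i _.
  by rewrite /g /tail ltNge (le_trans F00 (ltW (m0 k)))/= mul0r !mulr0.
apply: (@le_trans _ _ (\sum_(k < M) c k * tail (m k) x)).
  apply: ler_sum => k _; rewrite -mulr_suml; apply: ler_piMl.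
    exact: mulr_ge0.
  exact: maximal_above_indic_le1.
apply: (@le_trans _ _ (C * (Phi (F x) / F x) * (F x * w x))); last first.
  by rewrite -!mulrA (mulrA _^-1) mulVf ?mul1r// gt_eqF.
apply: le_trans (ler_wpM2r _ (hC l _ M l0 Fx0)); last by rewrite mulr_ge0.
rewrite mulr_suml [leRHS]big_mkcond; apply: ler_sum => k _.
rewrite /tail /c -/(m k); case: ifP => _; first by rewrite mul1r.
by rewrite mul0r mulr0.
Qed.

End OneFunction.
End Stopping.

(** * The multilinear Carleson estimate on a finite nested family *)

Section Core.
Context {R : realType} {d} {T : measurableType d} (mu : {measure set T -> \bar R}).
Context {I : finType} (Q : I -> set T).
Hypotheses (mQ : forall i, measurable (Q i)) (Qinj : injective Q).
Hypothesis nested : forall i j x, Q i x -> Q j x -> Q i `<=` Q j \/ Q j `<=` Q i.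

(** Put [y := Phi^-1 (1/s)].  The hypothesis says [u <= y], and the inequality is
[Psi u / Phi u <= Psi y / Phi y] with [Phi y = 1/s]. *)
Lemma growth_ratio_inv_le (Phi Psi : R -> R) (u s : R) : growth_pos Phi -> growth_pos Psi ->
  nondecreasing_pos (fun t => Psi t / Phi t) -> 0 < u -> 0 < s -> Phi u * s <= 1 ->
  Psi u / Psi (growth_inv Phi s^-1) <= Phi u * s.
Proof.
move=> gPhi gPsi mono u0 s0 us.
have si0 : 0 < s^-1 by rewrite invr_gt0.
have w0 := growth_inv_gt0 gPhi si0.
have uw : u <= growth_inv Phi s^-1.
  apply: (le_growth_inv gPhi); first exact: ltW.
  by rewrite -[s^-1]mul1r ler_pdivlMr.
have := mono _ _ u0 uw; rewrite (growth_invK gPhi (ltW si0)) invrK.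
rewrite ler_pdivrMr ?(gp_pos gPhi)// => h.
rewrite ler_pdivrMr ?(gp_pos gPsi)//.
by rewrite (_ : Phi u * s * _ = Psi (growth_inv Phi s^-1) * s * Phi u)//; ring.
Qed.

Section MainBound.
Variables (n : nat) (hn : (0 < n)%N).
Variables (Phi : 'I_n -> R -> R) (Psi : R -> R) (D : R) (C : 'I_n -> R).
Hypotheses (gPhi : forall j, growth_pos (Phi j)) (gPsi : growth_pos Psi).
Hypothesis mono : forall j, nondecreasing_pos (fun t => Psi t / Phi j t).
Hypothesis (D1 : 1 <= D).
Hypothesis (hD : forall s t : R, 0 <= s -> 0 <= t -> Psi (s * t) <= D * Psi s * Psi t).
Hypothesis C0 : forall j, 0 < C j.
Hypothesis hC : forall j, dyadic_sums_le (Phi j) (C j).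
Variables (w F : 'I_n -> T -> R) (S A : 'I_n -> I -> R) (kap : I -> R) (v : T -> R) (K : R).
Hypotheses (mw : forall j, measurable_fun setT (w j)) (w0 : forall j x, 0 <= w j x).
Hypotheses (mF : forall j, measurable_fun setT (F j)) (F0 : forall j x, 0 <= F j x).
Hypotheses (mv : measurable_fun setT v) (v0 : forall x, 0 <= v x).
Hypothesis (SE : forall j i, (\int[mu]_(x in Q i) (w j x)%:E = (S j i)%:E)%E).
Hypothesis (AE : forall j i, (\int[mu]_(x in Q i) (F j x * w j x)%:E = (A j i)%:E)%E).
Hypothesis (PhiF : forall j, (\int[mu]_x (Phi j (F j x) * w j x)%:E <= 1)%E).
Hypothesis S0 : forall j i, 0 < S j i.
Hypothesis K0 : 0 <= K.
Hypothesis kap0 : forall i, 0 <= kap i.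

(** The discrete counterpart on [Q r] of the maximal function of the weights
restricted to [Q r]. *)
Definition local_maximal (r : I) (x : T) : R :=
  \big[Num.max/0]_(i | `[< Q i `<=` Q r >]) (\1_(Q i) x * (kap i * \prod_j S j i)).

Hypothesis test : forall r,
  ((\prod_j Psi (growth_inv (Phi j) (S j r)^-1))%:E *
   \int[mu]_(x in Q r) (Psi (local_maximal r x) * v x)%:E <= K%:E)%E.

Lemma sum_stopping_le (j : 'I_n) (l : R) (M : nat) : 0 < l ->
  \sum_(p : 'I_M * I | `[< maximal_above Q (S j) (A j) (2 * (l * 2 ^+ p.1)) p.2 >])
     Psi (l * 2 ^+ p.1) / Psi (growth_inv (Phi j) (S j p.2)^-1) <= C j.
Proof.
move=> l0.
have := sum_Phi_mass_le mQ nested (gPhi j) (mw j) (w0 j) (mF j) (F0 j)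
  (SE j) (AE j) (PhiF j) M (C0 j) l0 (hC j).
apply: le_trans; rewrite pair_big_dep /=; apply: ler_sum => -[k i] /= /asboolP[Ai _].
have m0 : 0 < l * 2 ^+ k by rewrite mulr_gt0// exprn_gt0.
apply: growth_ratio_inv_le => //.
exact: (Phi_mass_le1 mQ (gPhi j) (mw j) (w0 j) (mF j) (F0 j) (SE j) (AE j) (PhiF j)).
Qed.

(** Sets with a common point form a chain. *)
Lemma smallest_exists (h : 'I_n -> I) (x : T) : (forall j, Q (h j) x) ->
  exists j0, forall j, Q (h j0) `<=` Q (h j).
Proof.
move=> hx; pose c r := #|[pred k | `[< Q k `<=` Q r >]]|.
case: (@arg_minnP _ (Ordinal hn) xpredT (c \o h) isT) => j0 _ j0min.
exists j0 => j; have [//|sub] := nested (hx j0) (hx j).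
have subP : [pred k | `[< Q k `<=` Q (h j) >]] \subset [pred k | `[< Q k `<=` Q (h j0) >]].
  by apply/fintype.subsetP => k; rewrite !inE => kr; exact: (subset_trans kr sub).
have /subset_cardP/(_ subP)/(_ (h j0)) : #|[pred k | `[< Q k `<=` Q (h j) >]]| =
    #|[pred k | `[< Q k `<=` Q (h j0) >]]|.
  by apply/eqP; rewrite eqn_leq subset_leq_card//=; exact: j0min.
rewrite !inE => jrE; have /asboolP := subset_refl (A := Q (h j0)).
by rewrite -jrE => /asboolP.
Qed.

Lemma local_maximal_ge0 r x : 0 <= local_maximal r x.
Proof. exact: bigmax_ge_id. Qed.

Let lm (r : I) (x : T) := Psi (local_maximal r x) * v x.

Let lm_ge0 r x : 0 <= lm r x.
Proof. by rewrite mulr_ge0// (growth_ge0 gPsi)// local_maximal_ge0. Qed.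

Let mlm r : measurable_fun setT (lm r).
Proof.
apply: measurable_funM => //; apply: (measurable_growth_comp gPsi); first exact: local_maximal_ge0.
by apply: measurable_bigmaxr => i; apply: measurable_funM.
Qed.

(** A record has a different set [q j] for each [j], but the testing condition is
used on the smallest of them; enlarging the sets decreases the product. *)
Lemma test_subset (r : I) (q : 'I_n -> I) : (forall j, Q r `<=` Q (q j)) ->
  (\int[mu]_(x in Q r) (lm r x)%:E <=
   (K / \prod_j Psi (growth_inv (Phi j) (S j (q j))^-1))%:E)%E.
Proof.
move=> rq.
have S_le j : S j r <= S j (q j).
  rewrite -lee_fin -!SE; apply: ge0_subset_integral => //.
    by apply/measurable_EFinP; exact: measurable_funTS.
  by move=> x _; rewrite lee_fin.
have Pq : 0 < \prod_j Psi (growth_inv (Phi j) (S j (q j))^-1).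
  apply: prodr_gt0 => j _; apply/(gp_pos gPsi)/(growth_inv_gt0 (gPhi j)).
  by rewrite invr_gt0.
have qr : \prod_j Psi (growth_inv (Phi j) (S j (q j))^-1) <=
          \prod_j Psi (growth_inv (Phi j) (S j r)^-1).
  apply: ler_prod => j _.
  have q0 : 0 <= (S j (q j))^-1 by rewrite invr_ge0 ltW.
  rewrite (growth_ge0 gPsi) ?(growth_inv_ge0 (gPhi j))//=.
  apply: (growth_le gPsi); first exact: (growth_inv_ge0 (gPhi j)).
  by apply: (growth_inv_le (gPhi j)) => //; rewrite lef_pV2 ?posrE.
have X0 : (0 <= \int[mu]_(x in Q r) (lm r x)%:E)%E.
  by apply: integral_ge0 => x _; rewrite lee_fin.
rewrite EFinM muleC lee_pdivlMl//.
by apply: le_trans (test r); rewrite lee_wpmul2r// lee_fin.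
Qed.

(** The smallest of the sets [Q (h j)], characterised so that it contains every
member of the family contained in all of them. *)
Let meet (h : 'I_n -> I) (r : I) : Prop :=
  (forall j, Q r `<=` Q (h j)) /\
  forall r', (forall j, Q r' `<=` Q (h j)) -> Q r' `<=` Q r.

Let meet_pick (h : {ffun 'I_n -> I}) : option I := [pick r | `[< meet h r >]].

Let meet_lm (h : {ffun 'I_n -> I}) (x : T) : R :=
  if meet_pick h is Some r then \1_(Q r) x * lm r x else 0.

Let meet_lm_ge0 h x : 0 <= meet_lm h x.
Proof. by rewrite /meet_lm; case: meet_pick => // r; rewrite mulr_ge0. Qed.

Let mmeet_lm h : measurable_fun setT (meet_lm h).
Proof.
rewrite /meet_lm; case: meet_pick => [r|]; last exact: measurable_cst.
exact: measurable_funM.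
Qed.

Let integral_meet_lm (h : {ffun 'I_n -> I}) :
  (\int[mu]_x (meet_lm h x)%:E <=
   (K / \prod_j Psi (growth_inv (Phi j) (S j (h j))^-1))%:E)%E.
Proof.
have P0 : 0 <= \prod_j Psi (growth_inv (Phi j) (S j (h j))^-1).
  apply: prodr_ge0 => j _; apply/(growth_ge0 gPsi)/(growth_inv_ge0 (gPhi j)).
  by rewrite invr_ge0 ltW.
rewrite /meet_lm /meet_pick; case: pickP => [r /asboolP[rh _]|_].
  by rewrite -integral_indicl; exact: test_subset.
by rewrite integral0 lee_fin divr_ge0.
Qed.

Let meet_lm_ge (i : I) (x : T) (h : {ffun 'I_n -> I}) : Q i x ->
  (forall j, Q i `<=` Q (h j)) -> Psi (kap i * \prod_j S j i) * v x <= meet_lm h x.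
Proof.
move=> ix ih; rewrite /meet_lm /meet_pick; case: pickP => [r /asboolP[rh rmax]|none].
  have ir := rmax _ ih.
  rewrite indicE mem_set ?mul1r; last exact: ir.
  rewrite ler_wpM2r//; apply: (growth_le gPsi).
    by rewrite mulr_ge0// prodr_ge0// => j _; exact: ltW.
  apply: (@le_trans _ _ (\1_(Q i) x * (kap i * \prod_j S j i))).
    by rewrite indicE mem_set// mul1r.
  by apply: (@le_bigmax_cond _ _ _ _ _ (fun i => `[< Q i `<=` Q r >])); exact/asboolP.
have [j0 hj0] := smallest_exists (fun j => ih j x ix).
have := none (h j0); rewrite /= => /negP []; by apply/asboolP; split.
Qed.

(** At each point only one cube matters, the one attaining the maximum, so a
single record [h] dominates the left-hand side and the sum over all records is a
pointwise majorant.  The factor [4] is the loss in the choice of the level: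
[2 m < A / S <= 4 m]. *)
Lemma carleson_max_bound :
  (\int[mu]_x (Psi (\big[Num.max/0]_i (\1_(Q i) x * (kap i * \prod_j A j i))) * v x)%:E
   <= (D ^+ n * (D * Psi 4) ^+ n * (\prod_j C j) * K)%:E)%E.
Proof.
have D0 : 0 <= D by exact: le_trans D1.
have [l2 [M [l20 hl]]] := @level_pick R ('I_n * I)%type (fun p => A p.1 p.2 / S p.1 p.2).
pose l := l2 / 2; have l0 : 0 < l by rewrite divr_gt0.
pose m (k : nat) := l * 2 ^+ k.
have m0 k : 0 < m k by rewrite mulr_gt0// exprn_gt0.
pose st j (p : 'I_M * I) := `[< maximal_above Q (S j) (A j) (2 * m p.1) p.2 >].
pose B := D ^+ n * (D * Psi 4) ^+ n.
have Psi4 : 0 <= Psi 4 by rewrite (growth_ge0 gPsi).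
have B0 : 0 <= B by rewrite mulr_ge0 ?exprn_ge0// mulr_ge0.
pose snd_of (h : {ffun 'I_n -> 'I_M * I}) := [ffun j => (h j).2].
pose G (h : {ffun 'I_n -> 'I_M * I}) x := B * \prod_j Psi (m (h j).1) * meet_lm (snd_of h) x.
have Pm (h : {ffun 'I_n -> 'I_M * I}) : 0 <= \prod_j Psi (m (h j).1).
  by apply: prodr_ge0 => j _; rewrite (growth_ge0 gPsi)// ltW.
have G0 h x : 0 <= G h x by rewrite mulr_ge0// mulr_ge0.
have mG h : measurable_fun setT (fun x => (G h x)%:E).
  by apply/measurable_EFinP; apply: measurable_funM.
have A0 j i : 0 <= A j i.
  rewrite -lee_fin -AE; apply: integral_ge0 => x _.
  by rewrite lee_fin mulr_ge0.
(* A record h lists for each j a level and a maximal set above that level. *)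
have key x : Psi (\big[Num.max/0]_i (\1_(Q i) x * (kap i * \prod_j A j i))) * v x <=
    \sum_(h in family st) G h x.
  have [->|[i _ ->]] := bigmaxr_attained predT (fun i => \1_(Q i) x * (kap i * \prod_j A j i)).
    by rewrite growth0// mul0r sumr_ge0.
  rewrite indicE; case: (boolP (x \in Q i)) => [|_]; last first.
    by rewrite mul0r growth0// mul0r sumr_ge0.
  rewrite inE mul1r => ix.
  have [/existsP[j /eqP Aj0]|] := boolP [exists j, A j i == 0].
    by rewrite (bigD1 j)//= Aj0 mul0r mulr0 growth0// mul0r sumr_ge0.
  rewrite negb_exists => /forallP Aneq0.
  have Agt0 j : 0 < A j i by rewrite lt_neqAle eq_sym Aneq0 A0.
  have /fin_all_exists[f hf] j : exists p : 'I_M * I,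
     [/\ st j p, Q i `<=` Q p.2 & A j i / S j i <= 4 * m p.1].
    have [/= k /andP[k1 k2]] := hl (j, i) (divr_gt0 (Agt0 j) (S0 j i)).
    have mk : 2 * m k = l2 * 2 ^+ k by rewrite /m /l mulrA mulrCA divff ?mulr1.
    move: k1; rewrite -mk ltr_pdivlMr// => k1.
    have [r ir rst] := maximal_above_exists Qinj k1.
    exists (k, r); split => //=; first exact/asboolP.
    by apply: le_trans k2 _; rewrite -mk mulrA -natrM.
  pose h := [ffun j => f j].
  have hst : h \in family st by apply/familyP => j; rewrite ffunE; have [] := hf j.
  apply: (@le_trans _ _ (G h x)); last first.
    by rewrite (bigD1 h)//= lerDl sumr_ge0.
  have le1 : Psi (kap i * \prod_j A j i) <=
      B * \prod_j Psi (m (h j).1) * Psi (kap i * \prod_j S j i).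
    have -> : kap i * \prod_j A j i = kap i * \prod_j S j i * \prod_j (A j i / S j i).
      rewrite -mulrA -big_split/=; congr (_ * _); apply: eq_bigr => j _.
      by rewrite mulrCA divff ?mulr1// gt_eqF.
    have kS0 : 0 <= kap i * \prod_j S j i.
      by rewrite mulr_ge0// prodr_ge0// => j _; exact: ltW.
    apply: (@le_trans _ _ (Psi (kap i * \prod_j S j i * \prod_j (4 * m (h j).1)))).
      apply: (growth_le gPsi).
        by rewrite mulr_ge0// prodr_ge0// => j _; rewrite divr_ge0// ltW.
      rewrite ler_wpM2l//; apply: ler_prod => j _.
      by rewrite divr_ge0 ?(ltW (S0 j i))//= ffunE; have [] := hf j.
    apply: le_trans (Delta'_prod gPsi D1 hD kS0 _) _.
      by move=> j; rewrite mulr_ge0// ltW.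
    rewrite -mulrA [X in _ <= X](_ : _ = D ^+ n * (Psi (kap i * \prod_j S j i) *
       ((D * Psi 4) ^+ n * \prod_j Psi (m (h j).1)))); last by rewrite /B; ring.
    rewrite ler_wpM2l ?exprn_ge0// ler_wpM2l ?(growth_ge0 gPsi)//.
    have -> : (D * Psi 4) ^+ n = \prod_(j < n) (D * Psi 4).
      by rewrite prodr_const card_ord.
    rewrite -big_split/=.
    apply: ler_prod => j _; apply/andP; split; last by apply: hD => //; exact: ltW.
    by apply: (growth_ge0 gPsi); apply: mulr_ge0 => //; exact: ltW.
  apply: le_trans (ler_wpM2r (v0 x) le1) _.
  rewrite /G -[leLHS]mulrA; apply: ler_wpM2l; first by rewrite mulr_ge0.
  by apply: meet_lm_ge => // j; rewrite !ffunE; have [] := hf j.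
apply: (@le_trans _ _ (\int[mu]_x (\sum_(h in family st) (G h x)%:E))%E).
  apply: ge0_le_integral => //.
  - move=> x _; rewrite lee_fin mulr_ge0// (growth_ge0 gPsi)//.
    exact: bigmax_ge_id.
  - apply/measurable_EFinP; apply: measurable_funM => //; apply: (measurable_growth_comp gPsi).
      by move=> x; exact: bigmax_ge_id.
    by apply: measurable_bigmaxr => i; apply: measurable_funM.
  - exact: emeasurable_sum_cond.
  - by move=> x _; rewrite sumEFin lee_fin.
rewrite ge0_integral_sum_cond//.
apply: (@le_trans _ _ (\sum_(h in family st)
   (B * K * \prod_j (Psi (m (h j).1) / Psi (growth_inv (Phi j) (S j (h j).2)^-1)))%:E))%E.
  apply: lee_sum => h _; under eq_integral do rewrite EFinM.
  rewrite ge0_integralZl//; last 3 first.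
  - exact/measurable_EFinP.
  - by move=> x _; rewrite lee_fin.
  - by rewrite lee_fin mulr_ge0.
  apply: (@le_trans _ _ ((B * \prod_j Psi (m (h j).1))%:E *
    (K / \prod_j Psi (growth_inv (Phi j) (S j (snd_of h j))^-1))%:E)%E).
    by rewrite lee_wpmul2l// lee_fin mulr_ge0.
  rewrite -EFinM lee_fin prodf_div/= le_eqVlt; apply/orP; left; apply/eqP.
  under [in LHS]eq_bigr do rewrite /=.
  rewrite (_ : \prod_j Psi (growth_inv (Phi j) (S j (snd_of h j))^-1) =
     \prod_j Psi (growth_inv (Phi j) (S j (h j).2)^-1)); last first.
    by apply: eq_bigr => j _; rewrite ffunE.
  by rewrite mulrACA !mulrA.
(* The records are all the families indexed by j, so the sum of products is the
   product of the sums bounded by sum_stopping_le. *)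
rewrite sumEFin lee_fin -mulr_sumr.
have <- := bigA_distr_big_dep (times := *%R) (plus := +%R) st
  (fun j p => Psi (m p.1) / Psi (growth_inv (Phi j) (S j p.2)^-1)).
rewrite [leRHS](_ : _ = B * K * \prod_j C j); last by rewrite /B; ring.
apply: ler_wpM2l.
  by rewrite mulr_ge0// K0.
apply: ler_prod => j _; rewrite sumr_ge0/=; last first.
  move=> p _; rewrite divr_ge0 ?(growth_ge0 gPsi) ?(ltW (m0 _))//.
  by rewrite (growth_inv_ge0 (gPhi j))// invr_ge0 ltW.
exact: sum_stopping_le.
Qed.

End MainBound.
End Core.

(** * Cubes in Euclidean space and shifted dyadic grids *)

Section Geometry.
Context {R : realType} {d : nat}.
Local Notation E := (Rd R d).
Local Notation co x i := (tnth (x : d.-tuple R) i).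

Lemma measurable_coord (i : 'I_d) : measurable_fun setT (fun x : E => co x i).
Proof.
move=> _ Y mY; rewrite setTI.
apply: sub_caratheodory; apply: sub_sigma_algebra.
have := @measurable_tnth _ (measurableTypeR R) d i measurableT Y mY.
by rewrite setTI.
Qed.

(** Half-open, so that the cubes of one generation of a grid are disjoint. *)
Definition hcube (a : 'I_d -> R) (s : R) : set E :=
  [set x | forall i, a i <= co x i < a i + s].

Lemma measurable_box (J : 'I_d -> interval R) :
  measurable ([set x | forall i, co x i \in J i] : set E).
Proof.
have -> : [set x : E | forall i, co x i \in J i] =
    \bigcap_(i in [set: 'I_d]) ((fun x : E => co x i) @^-1` [set` J i]).
  by apply/seteqP; split=> x /= h i => [_|]; exact: h.
apply: fin_bigcap_measurable => // i _; rewrite -[X in measurable X]setTI.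
by apply: measurable_coord => //; exact: measurable_itv.
Qed.

Lemma measurable_cube (a : 'I_d -> R) s : measurable (cube a s : set E).
Proof.
rewrite (_ : cube a s = [set x : E | forall i, co x i \in `[a i, a i + s]]).
  exact: measurable_box.
by apply/seteqP; split=> x /= h i; have := h i; rewrite in_itv.
Qed.

Lemma measurable_hcube (a : 'I_d -> R) s : measurable (hcube a s : set E).
Proof.
rewrite (_ : hcube a s = [set x : E | forall i, co x i \in `[a i, a i + s[]).
  exact: measurable_box.
by apply/seteqP; split=> x /= h i; have := h i; rewrite in_itv.
Qed.

Lemma hcube_sub_cube (a : 'I_d -> R) s : hcube a s `<=` cube a s.
Proof. by move=> x h i; have /andP[-> /ltW] := h i. Qed.

Lemma exprn_root_exists (x : R) (n : nat) : (0 < n)%N -> 0 <= x ->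
  exists2 u : R, 0 <= u & u ^+ n = x.
Proof.
move=> n0 x0; exists (x `^ (n%:R^-1)); first exact: powR_ge0.
rewrite -powR_mulrn ?powR_ge0// -powRrM mulVf ?powRr1// pnatr_eq0.
by rewrite -lt0n.
Qed.

(** A half-open cube contains the closed cubes with the same corner and smaller
side. *)
Lemma leb_hcube (a : 'I_d -> R) (s : R) : (0 < d)%N -> 0 < s ->
  leb R d (hcube a s) = (s ^+ d)%:E.
Proof.
move=> d0 s0.
have hle : (leb R d (hcube a s) <= (s ^+ d)%:E)%E.
  rewrite -(leb_cube a s0); apply: le_measure; rewrite ?inE.
  - exact: measurable_hcube.
  - exact: measurable_cube.
  - exact: hcube_sub_cube.
have hge t : 0 < t -> t < s -> ((t ^+ d)%:E <= leb R d (hcube a s))%E.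
  move=> t0 ts; rewrite -(leb_cube a t0); apply: le_measure; rewrite ?inE.
  - exact: measurable_cube.
  - exact: measurable_hcube.
  - by move=> x h i; have /andP[-> /le_lt_trans -> //] := h i; rewrite ltrD2l.
have : (0 <= leb R d (hcube a s))%E by exact: measure_ge0.
move: hle hge.
case: (leb R d (hcube a s)) => [y| |] //.
rewrite !lee_fin => ys hge y0; congr (_%:E); apply/eqP; rewrite eq_le ys /=.
rewrite leNgt; apply/negP => ys'.
have [u u0 uy] := exprn_root_exists d0 y0.
have us : u < s by rewrite -(ltr_pXn2r d0) ?nnegrE ?uy// ltW.
have h1 : 0 < (u + s) / 2 by lra.
have h2 : (u + s) / 2 < s by lra.
have := hge _ h1 h2; rewrite lee_fin -uy ler_pXn2r ?nnegrE ?(ltW h1)//.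
lra.
Qed.

Lemma leb_cubeD_hcube (a : 'I_d -> R) (s : R) : (0 < d)%N -> 0 < s ->
  leb R d (cube a s `\` hcube a s) = 0%E.
Proof.
move=> d0 s0.
have fin : (leb R d (cube a s) < +oo)%E by rewrite leb_cube// ltry.
rewrite measureD; last 3 first.
- exact: measurable_cube.
- exact: measurable_hcube.
- exact: fin.
rewrite setIidr; last exact: hcube_sub_cube.
transitivity ((s ^+ d)%:E - (s ^+ d)%:E)%E; last by rewrite -EFinB subrr.
by congr (_ - _)%E; [exact: leb_cube|exact: leb_hcube].
Qed.

Lemma integral_cube_hcube (a : 'I_d -> R) (s : R) (f : E -> \bar R) :
  (0 < d)%N -> 0 < s -> measurable_fun setT f -> (forall x, 0 <= f x)%E ->
  (\int[leb R d]_(x in cube a s) f x = \int[leb R d]_(x in hcube a s) f x)%E.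
Proof.
move=> d0 s0 mf f0.
rewrite (@ge0_negligible_integral _ _ _ _ _ (cube a s `\` hcube a s)).
- by rewrite setDD setIidr//; exact: hcube_sub_cube.
- by apply: measurableD; [exact: measurable_cube|exact: measurable_hcube].
- exact: measurable_cube.
- exact: measurable_funTS.
- by move=> x _.
- exact: leb_cubeD_hcube.
Qed.

(** The grid of step [L = L0 / 2^k] and its translate by [L0 / 3] have their points
at distance at least [L / 3] from each other, because [2^k] is not divisible by
3; so an interval shorter than [L / 3] cannot contain points of both. *)
Lemma one_third_trick (a s L0 : R) (k : nat) : 0 < s -> 3 * s < L0 / 2 ^+ k ->
  exists (b : bool) (z : int),
    b%:R * (L0 / 3) + L0 / 2 ^+ k * z%:~R <= a /\
    a + s < b%:R * (L0 / 3) + L0 / 2 ^+ k * z%:~R + L0 / 2 ^+ k.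
Proof.
move=> s0; set L := L0 / 2 ^+ k => sL.
have L0' : 0 < L by lra.
pose z := Num.floor (a / L).
have /andP[z1 z2] : z%:~R <= a / L < (z + 1)%:~R by exact: floor_itv.
rewrite ler_pdivlMr// in z1; rewrite ltr_pdivrMr// intrD mulrDl mul1r in z2.
have [h|h] := ltP (a + s) (L * z%:~R + L).
  by exists false, z; rewrite !mul0r !add0r; split=> //; rewrite mulrC.
(* Modulo the step L, the translation by L0 / 3 = 2^k L / 3 is one by r L / 3. *)
have [p [r [r12 pr]]] : exists (p r : nat), (r = 1 \/ r = 2)%N /\ (2 ^ k = 3 * p + r)%N.
  elim: k {L sL L0' z z1 z2 h} => [|k [p [r [[->|->] pr]]]].
  - by exists 0%N, 1%N; split; [left|].
  - by exists (2 * p)%N, 2%N; split; [right|rewrite expnS pr; lia].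
  - by exists (2 * p + 1)%N, 1%N; split; [left|rewrite expnS pr; lia].
exists true, (z - p%:Z).
have -> : L0 / 3 = L * p%:R + L * r%:R / 3.
  have -> : L0 = L * (3 * p + r)%:R.
    by rewrite -pr natrX /L mulfVK// expf_neq0.
  by rewrite natrD natrM; field.
rewrite mul1r intrB mulrBr.
have -> : (p%:Z)%:~R = p%:R :> R by [].
by case: r12 => ->; split; nra.
Qed.

(** Generation [k] of the grid with top side [L0], translated by [L0 / 3] in the
coordinates selected by [e]. *)
Definition dyadic (L0 : R) (e : {ffun 'I_d -> bool}) (k : nat) (z : {ffun 'I_d -> int}) : set E :=
  hcube (fun i => (e i)%:R * (L0 / 3) + L0 / 2 ^+ k * (z i)%:~R) (L0 / 2 ^+ k).

(** In units of the finer side, the faces of both cubes have integer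
coordinates. *)
Lemma dyadic_sub (L0 : R) e k k' z z' x : 0 < L0 -> (k <= k')%N ->
  dyadic L0 e k z x -> dyadic L0 e k' z' x -> dyadic L0 e k' z' `<=` dyadic L0 e k z.
Proof.
move=> L00 kk' hx hx' y hy i.
have := hx i; have := hx' i; have := hy i.
set t := _%:R * _; set L := L0 / 2 ^+ k'.
have -> : L0 / 2 ^+ k = L * (2 ^ (k' - k))%:R.
  rewrite /L -{1}(subnKC kk') exprD natrX; field.
  by rewrite !expf_neq0.
have L0' : 0 < L by rewrite divr_gt0// exprn_gt0.
set N := (2 ^ (k' - k))%N.
move=> /andP[y1 y2] /andP[x1 x2] /andP[x3 x4].
have h1 : N%:Z * z i < z' i + 1.
  rewrite -(ltr_int R) intrM intrD -(ltr_pM2l L0') mulrA.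
  by have -> : (N%:Z)%:~R = N%:R :> R by []; lra.
have h2 : z' i < N%:Z * (z i + 1).
  rewrite -(ltr_int R) intrM intrD -(ltr_pM2l L0') mulrA mulrDr mulr1.
  by have -> : (N%:Z)%:~R = N%:R :> R by []; lra.
have NE : (N%:Z)%:~R = N%:R :> R by [].
have h3 : N%:R * (z i)%:~R <= (z' i)%:~R :> R.
  by rewrite -NE -intrM ler_int; lia.
have h4 : (z' i)%:~R + 1 <= N%:R * ((z i)%:~R + 1) :> R.
  by rewrite -NE -[1]/(1%:~R) -!intrD -intrM ler_int; lia.
have := ler_wpM2l (ltW L0') h3; have := ler_wpM2l (ltW L0') h4.
rewrite !mulrDr !mulr1 => h5 h6.
by apply/andP; split; lra.
Qed.

(** Take the finest generation whose side still exceeds [3 s] and apply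
[one_third_trick] in each coordinate. *)
Lemma cube_sub_dyadic (L0 : R) (a : 'I_d -> R) (s : R) : 0 < s -> 3 * s < L0 ->
  exists (e : {ffun 'I_d -> bool}) (k : nat) (z : {ffun 'I_d -> int}),
    cube a s `<=` dyadic L0 e k z /\ L0 / 2 ^+ k <= 6 * s.
Proof.
move=> s0 sL.
have exk : exists k, L0 / 2 ^+ k <= 6 * s.
  exists (Num.truncn (L0 / (6 * s))).+1.
  rewrite ler_pdivrMr ?exprn_gt0// mulrC -ler_pdivrMr ?mulr_gt0//.
  apply: ltW; apply: lt_le_trans (truncnS_gt _) _.
  by rewrite -natrX ler_nat ltnW// ltn_expl.
case: (ex_minnP exk) => k hk kmin.
have kL : 3 * s < L0 / 2 ^+ k.
  case: k hk kmin => [|k] hk kmin; first by rewrite expr0 divr1.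
  rewrite ltNge; apply/negP => h; suff /kmin : L0 / 2 ^+ k <= 6 * s by rewrite ltnn.
  rewrite exprS invfM mulrCA in h; lra.
have /fin_all_exists[f hf] (i : 'I_d) : exists p : bool * int,
    p.1%:R * (L0 / 3) + L0 / 2 ^+ k * p.2%:~R <= a i /\
    a i + s < p.1%:R * (L0 / 3) + L0 / 2 ^+ k * p.2%:~R + L0 / 2 ^+ k.
  by have [b [z h]] := one_third_trick (a i) s0 kL; exists (b, z).
exists [ffun i => (f i).1], k, [ffun i => (f i).2]; split=> // x hx i.
have [h1 h2] := hf i; have /andP[x1 x2] := hx i.
by rewrite !ffunE (le_trans h1)//= (le_lt_trans x2).
Qed.

End Geometry.

(** * The maximal function as a countable supremum *)

Section ComplexModulus.
Context {R : realType}.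

Lemma modulus_ge0 (z : R[i]) : 0 <= modulus z.
Proof. by case: z => a b; exact: sqrtr_ge0. Qed.

Lemma modulus_real (r : R) : modulus (r%:C)%C = `|r|.
Proof. by rewrite /modulus /= expr0n addr0 sqrtr_sqr. Qed.

Lemma modulusM (y z : R[i]) : modulus (y * z) = modulus y * modulus z.
Proof. exact: ComplexField.Normc.normcM. Qed.

Lemma measurable_modulus {d : nat} (f : Rd R d -> R[i]) : measurable_complex f ->
  measurable_fun setT (fun x => modulus (f x)).
Proof.
move=> [mRe mIm].
rewrite (_ : (fun x => modulus (f x)) =
    (fun x => Num.sqrt ((complex.Re (f x)) ^+ 2 + (complex.Im (f x)) ^+ 2))).
  have ms : measurable_fun (setT : set R) (@Num.sqrt R : R -> R).
    apply: continuous_measurable_fun; exact: sqrt_continuous.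
  by apply: (measurableT_comp ms); apply: measurable_funD; apply: measurable_funX.
by apply/funext => x; rewrite /modulus; case: (f x).
Qed.

End ComplexModulus.

Section MaximalFunction.
Context {R : realType} {d n : nat}.
Hypotheses (hd : (0 < d)%N) (hn : (0 < n)%N).
Variable alpha : R.
Hypothesis alpha0 : 0 <= alpha.
Local Notation E := (Rd R d).
Local Notation co x i := (tnth (x : d.-tuple R) i).

(** [|Q|^(alpha/d)] times the [n] factors [1/|Q|] of the averages, as a function of
the volume. *)
Definition frac_coef (V : R) : R := V `^ (alpha / d%:R) * V^-1 ^+ n.

Lemma frac_coef_ge0 V : 0 <= V -> 0 <= frac_coef V.
Proof. by move=> V0; rewrite mulr_ge0 ?powR_ge0// exprn_ge0// invr_ge0. Qed.

Lemma frac_coef_le V V' t : 0 < V -> V <= V' -> V' <= t * V ->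
  frac_coef V <= t ^+ n * frac_coef V'.
Proof.
move=> V0 VV' V't; have V'0 := lt_le_trans V0 VV'.
rewrite /frac_coef [leRHS]mulrCA -exprMn; apply: ler_pM.
- exact: powR_ge0.
- by rewrite exprn_ge0// invr_ge0 ltW.
- by apply: ge0_ler_powR; rewrite ?nnegrE ?divr_ge0// ltW.
apply: lerXn2r; rewrite ?nnegrE ?invr_ge0 ?(ltW V0)//.
  by rewrite divr_ge0 ?(ltW V'0)// -(pmulr_lge0 _ V0) (le_trans (ltW V'0)).
by rewrite ler_pdivlMr// mulrC ler_pdivrMr.
Qed.

(** An enumeration of the cubes with rational corner and side; codes of no pair give
the unit cube at the origin. *)
Definition qcube_data (m : nat) : ({ffun 'I_d -> rat} * rat) :=
  odflt ([ffun => 0], 1) (unpickle m).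
Definition qcorner (m : nat) (i : 'I_d) : R := ratr ((qcube_data m).1 i).
(** Sides that are not positive are replaced by 1, so that every index denotes a
cube. *)
Definition qside (m : nat) : R :=
  if 0 < (qcube_data m).2 then ratr (qcube_data m).2 else 1.

Lemma qside_gt0 m : 0 < qside m.
Proof. by rewrite /qside; case: ifP => // h; rewrite ltr0q. Qed.

Lemma qcube_exists (a : {ffun 'I_d -> rat}) (s : rat) : 0 < s ->
  exists m, (forall i, qcorner m i = ratr (a i)) /\ qside m = ratr s.
Proof.
by move=> s0; exists (pickle (a, s)); rewrite /qcorner /qside /qcube_data pickleK /= s0.
Qed.

(** Choose a rational side between [s] and [t^(1/d) s], then a rational corner that
leaves room for the given cube. *)
Lemma qcube_approx (a : 'I_d -> R) (s t : R) : 0 < s -> 1 < t ->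
  exists m, [/\ (cube a s : set E) `<=` cube (qcorner m) (qside m), s <= qside m &
    qside m ^+ d <= t * s ^+ d].
Proof.
move=> s0 t1.
have ts0 : 0 <= t * s ^+ d by rewrite mulr_ge0 ?exprn_ge0// ?ltW// (lt_trans _ t1).
have [u u0 uE] := exprn_root_exists hd ts0.
have su : s < u.
  rewrite -(ltr_pXn2r hd) ?nnegrE ?(ltW s0)// uE ltr_pMl// exprn_gt0//.
have [q] := rat_in_itvoo su; rewrite in_itv/= => /andP[sq qu].
have /fin_all_exists[b hb] (i : 'I_d) : exists b : rat, a i + s - ratr q < ratr b < a i.
  have /rat_in_itvoo[b] : a i + s - ratr q < a i by lra.
  by rewrite in_itv/= => hb; exists b.
have q0 : 0 < q by rewrite -(ltr0q R) (lt_trans s0).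
have [m [ma ms]] := qcube_exists [ffun i => b i] q0.
exists m; rewrite ms; split; last 2 first.
- exact: ltW.
- by rewrite -uE lerXn2r ?nnegrE ?(ltW qu)// ltW// ltr0q.
move=> x hx i; rewrite ma ffunE.
have := hx i; have := hb i => /andP[h1 h2] /andP[h3 h4].
by apply/andP; split; lra.
Qed.

Variable f : 'I_n -> E -> R[i].
Hypothesis mf : forall j, measurable_fun setT (fun y => modulus (f j y)).
Hypothesis f_fin : forall j (a : 'I_d -> R) s, 0 < s ->
  (\int[leb R d]_(y in cube a s) (modulus (f j y))%:E < +oo)%E.

Definition cube_mass (j : 'I_n) (a : 'I_d -> R) (s : R) : R :=
  fine (\int[leb R d]_(y in cube a s) (modulus (f j y))%:E).

Lemma cube_massE j a s : 0 < s ->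
  (\int[leb R d]_(y in cube a s) (modulus (f j y))%:E = (cube_mass j a s)%:E)%E.
Proof.
move=> s0; rewrite /cube_mass fineK// ge0_fin_numE ?f_fin//.
by apply: integral_ge0 => y _; rewrite lee_fin modulus_ge0.
Qed.

Lemma cube_mass_ge0 j a s : 0 <= cube_mass j a s.
Proof. by apply: fine_ge0; apply: integral_ge0 => y _; rewrite lee_fin modulus_ge0. Qed.

Definition cube_avg a s : R := frac_coef (s ^+ d) * \prod_j cube_mass j a s.

Lemma cube_avg_ge0 a s : 0 < s -> 0 <= cube_avg a s.
Proof.
move=> s0; rewrite mulr_ge0 ?frac_coef_ge0 ?exprn_ge0 ?(ltW s0)//.
by rewrite prodr_ge0// => j _; exact: cube_mass_ge0.
Qed.

Lemma cube_mass_le j a s a' s' : 0 < s -> 0 < s' ->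
  (cube a s : set E) `<=` cube a' s' -> cube_mass j a s <= cube_mass j a' s'.
Proof.
move=> s0 s'0 sub; rewrite -lee_fin -!cube_massE//.
have mg : measurable_fun (cube a' s' : set E) (fun y => (modulus (f j y))%:E).
  by apply/measurable_EFinP; exact: measurable_funTS.
apply: (@ge0_subset_integral _ _ _ (leb R d) _ _ (measurable_cube a s)
  (measurable_cube a' s') _ mg _ sub).
by move=> y _; rewrite lee_fin modulus_ge0.
Qed.

Lemma maximal_termE a s (x : E) : 0 < s ->
  ((vol (cube a s : set E) `^ (alpha / d%:R))%:E *
    \prod_(i < n) ((\1_(cube a s) x / vol (cube a s : set E))%:E *
                   \int[leb R d]_(y in cube a s) (modulus (f i y))%:E) =
   (\1_(cube a s) x * cube_avg a s)%:E)%E.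
Proof.
move=> s0; have -> : vol (cube a s : set E) = s ^+ d by rewrite /vol leb_cube.
under eq_bigr do rewrite cube_massE// -EFinM.
rewrite prodEFin -EFinM; congr (_%:E).
rewrite /cube_avg /frac_coef !big_split/= !prodr_const card_ord.
have -> : (\1_(cube a s) x : R) ^+ n = \1_(cube a s) x.
  by rewrite indicE; case: (_ \in _); rewrite ?expr1n// expr0n; case: n hn.
by ring.
Qed.

(** Replacing a cube by a slightly larger rational one changes the term by a factor
as close to 1 as desired, since the integrals can only grow. *)
Lemma maximalE x : maximal alpha f x =
  ereal_sup (range (fun m => (\1_(cube (qcorner m) (qside m)) x *
      cube_avg (qcorner m) (qside m))%:E)).
Proof.
set M' := ereal_sup (range _); rewrite /maximal.
have M'0 : (0 <= M')%E.
  apply: le_trans (ereal_sup_ubound _); last by exists 0%N.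
  by rewrite lee_fin mulr_ge0 ?cube_avg_ge0 ?qside_gt0.
apply/eqP; rewrite eq_le; apply/andP; split; last first.
  apply: ge_ereal_sup => _ [m _ <-]; apply: ereal_sup_ubound.
  exists (cube (qcorner m) (qside m)).
    by exists (qcorner m), (qside m); split=> //; exact: qside_gt0.
  by rewrite maximal_termE ?qside_gt0.
apply: ge_ereal_sup => _ [Q [a [s [s0 ->]]] <-]; rewrite maximal_termE//.
rewrite indicE; case: (boolP (x \in _)) => [|_]; last by rewrite mul0r.
rewrite inE mul1r => xQ.
(* It suffices to lose an arbitrary factor t > 1. *)
have main t : 1 < t -> ((cube_avg a s)%:E <= t%:E * M')%E.
  move=> t1; have [u u0 uE] := exprn_root_exists hn (ltW (lt_trans ltr01 t1)).
  have u1 : 1 < u by rewrite -(ltr_pXn2r hn) ?nnegrE// expr1n uE.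
  have [m [sub sm mu]] := qcube_approx a s0 u1.
  apply: (@le_trans _ _ (t%:E * (cube_avg (qcorner m) (qside m))%:E)%E).
    rewrite -EFinM lee_fin /cube_avg mulrA; apply: ler_pM.
    - by rewrite frac_coef_ge0// exprn_ge0// ltW.
    - by rewrite prodr_ge0// => j _; exact: cube_mass_ge0.
    - rewrite -uE; apply: frac_coef_le => //; first exact: exprn_gt0.
      by rewrite lerXn2r ?nnegrE ?(ltW s0)// ltW ?qside_gt0.
    - apply: ler_prod => j _; rewrite cube_mass_ge0/=.
      by apply: cube_mass_le => //; exact: qside_gt0.
  apply: lee_wpmul2l; first by rewrite lee_fin (le_trans ler01)// ltW.
  apply: ereal_sup_ubound; exists m => //.
  by rewrite indicE mem_set ?mul1r//; exact: sub.
case: M' M'0 main => [r| |] //; last by move=> _ _; rewrite leey.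
rewrite !lee_fin => r0 main; rewrite leNgt; apply/negP => rt.
move: r0; rewrite le_eqVlt => /predU1P[r0|r0].
  have t2 : 1 < 2 :> R by rewrite ltr1n.
  by have := main 2 t2; rewrite -EFinM lee_fin; lra.
have h1 : 1 < (cube_avg a s + r) / (2 * r) by rewrite ltr_pdivlMr ?mulr_gt0//; lra.
have := main _ h1; rewrite -EFinM lee_fin.
have -> : (cube_avg a s + r) / (2 * r) * r = (cube_avg a s + r) / 2.
  by field; rewrite gt_eqF.
by lra.
Qed.

(** The finite stages of the monotone limit leading to the maximal function. *)
Definition max_first (N : nat) (x : E) : R :=
  \big[Num.max/0]_(m < N) (\1_(cube (qcorner m) (qside m)) x *
      cube_avg (qcorner m) (qside m)).

Lemma max_first_ge0 N x : 0 <= max_first N x.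
Proof. exact: bigmax_ge_id. Qed.

Lemma max_first_le x : {homo max_first ^~ x : N M / (N <= M)%N >-> N <= M}.
Proof.
move=> N M NM; apply: bigmax_le; first exact: max_first_ge0.
move=> m _; exact: (le_bigmax _ (fun m : 'I_M => \1_(cube (qcorner m) (qside m)) x *
      cube_avg (qcorner m) (qside m)) (widen_ord NM m)).
Qed.

Lemma measurable_max_first N : measurable_fun setT (max_first N).
Proof.
apply: measurable_bigmaxr => m; apply: measurable_funM.
  exact: measurable_indic (measurable_cube _ _).
exact: measurable_cst.
Qed.

Lemma maximal_sup_max_first x :
  maximal alpha f x = ereal_sup (range (fun N => (max_first N x)%:E)).
Proof.
rewrite maximalE; apply/eqP; rewrite eq_le; apply/andP; split.
  apply: ge_ereal_sup => _ [m _ <-].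
  apply: le_trans (ereal_sup_ubound _); last by exists m.+1.
  rewrite lee_fin.
  exact: (le_bigmax _ (fun m : 'I_(_.+1) => \1_(cube (qcorner m) (qside m)) x *
      cube_avg (qcorner m) (qside m)) ord_max).
apply: ge_ereal_sup => _ [N _ <-]; rewrite /max_first.
have [->|[m _ ->]] := bigmaxr_attained predT (fun m : 'I_N => \1_(cube (qcorner m) (qside m)) x *
      cube_avg (qcorner m) (qside m)); last first.
  by apply: ereal_sup_ubound; exists m.
apply: le_trans (ereal_sup_ubound _); last by exists 0%N.
by rewrite lee_fin mulr_ge0 ?cube_avg_ge0 ?qside_gt0.
Qed.

Lemma maximal_ge0 x : (0 <= maximal alpha f x)%E.
Proof.
rewrite maximal_sup_max_first; apply: le_trans (ereal_sup_ubound _); last by exists 0%N.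
by rewrite lee_fin max_first_ge0.
Qed.

Lemma measurable_maximal : measurable_fun setT (maximal alpha f).
Proof.
apply: (emeasurable_fun_cvg (fun N x => (max_first N x)%:E)).
  by move=> N; apply/measurable_EFinP; exact: measurable_max_first.
move=> x _; rewrite maximal_sup_max_first.
apply: ereal_nondecreasing_cvgn => N M NM.
by rewrite lee_fin max_first_le.
Qed.

End MaximalFunction.

(** * Monotone limits under a growth function *)

Section OrliczTools.
Context {R : realType} {disp} {T : measurableType disp} (mu : {measure set T -> \bar R}).

(** Lets one prove an inequality of extended reals below every real number, without
distinguishing whether [x] is infinite. *)
Lemma le_of_real_lt (x y : \bar R) : (0 <= y)%E ->
  (forall r : R, 0 <= r -> (r%:E < x)%E -> (r%:E <= y)%E) -> (x <= y)%E.
Proof.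
move=> y0 h; rewrite leNgt; apply/negP => yx.
case: y y0 h yx => [s| |] //.
  rewrite lee_fin => s0 h sx.
  case: x h sx => [t| |] // h.
    rewrite lte_fin => st; have := h ((s + t) / 2).
    rewrite lte_fin lee_fin; suff : 0 <= (s + t) / 2 by move=> /[swap] /[apply]; lra.
    lra.
  by move=> _; have := h (s + 1); rewrite ltry lee_fin => /(_ _ isT); lra.
by move=> _ _; rewrite ltNge leey.
Qed.

Lemma growth_er_map_le (Psi : R -> R) (m : R) (M : \bar R) : growth_pos Psi -> 0 <= m ->
  (m%:E <= M)%E -> ((Psi m)%:E <= er_map Psi M)%E.
Proof.
move=> gP m0; case: M => [r| |] //=; last by move=> _; rewrite leey.
by rewrite !lee_fin; exact: growth_le.
Qed.

(** For [r] below the right-hand side, the supremum exceeds [Psi^-1 r], hence so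
does some [g N]: surjectivity and monotonicity give the continuity that is
needed, including at infinity. *)
Lemma er_map_ereal_sup (Psi : R -> R) (g : nat -> R) (c : R) : growth_pos Psi ->
  0 < c -> (forall N, 0 <= g N) ->
  ereal_sup (range (fun N => (Psi (g N * c))%:E)) =
  er_map Psi (ereal_sup (range (fun N => (g N)%:E)) * c%:E).
Proof.
move=> gP c0 g0; set G := ereal_sup (range (fun N => (g N)%:E)).
have gG N : ((g N)%:E <= G)%E by apply: ereal_sup_ubound; exists N.
have G0 : (0 <= G)%E by apply: le_trans (gG 0%N); rewrite lee_fin.
apply/eqP; rewrite eq_le; apply/andP; split.
  apply: ge_ereal_sup => _ [N _ <-]; have := gG N.
  case: G G0 {gG} => [r| |] //=.
    rewrite !lee_fin => r0 Nr; apply: (growth_le gP); first by rewrite mulr_ge0// ltW.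
    by rewrite ler_wpM2r// ltW.
  by rewrite gt0_mulye ?lte_fin//= => _ _; rewrite leey.
apply: le_of_real_lt.
  apply: le_trans (ereal_sup_ubound _); last by exists 0%N.
  by rewrite lee_fin (growth_ge0 gP)// mulr_ge0// ltW.
move=> r r0 rG; pose u := growth_inv Psi r.
have u0 : 0 <= u by exact: (growth_inv_ge0 gP).
have uG : ((u / c)%:E < G)%E.
  rewrite ltNge; apply/negP => Gu; move: rG; rewrite ltNge => /negP; apply.
  case: G G0 Gu {gG} => [s| |] //.
  rewrite !lee_fin ler_pdivlMr// => s0 su.
  rewrite -(growth_invK gP r0); apply: (growth_le gP) => //.
  by rewrite mulr_ge0// ltW.
have [_ [N _ <-]] := ereal_sup_gt uG.
rewrite lte_fin ltr_pdivrMr// => uN.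
apply: le_trans (ereal_sup_ubound _); last by exists N.
rewrite lee_fin -[leLHS](growth_invK gP r0); apply: (growth_le gP) => //.
exact: ltW.
Qed.

Section MonotoneLimit.
Variables (Psi : R -> R) (gP : growth_pos Psi) (g : nat -> T -> R) (v : T -> R) (c : R).
Hypotheses (c0 : 0 < c) (g0 : forall N x, 0 <= g N x).
Hypotheses (gmono : forall x, {homo g ^~ x : N M / (N <= M)%N >-> N <= M}).
Hypotheses (mg : forall N, measurable_fun setT (g N)).
Hypotheses (mv : measurable_fun setT v) (v0 : forall x, 0 <= v x).

Let gc0 N x : 0 <= g N x * c. Proof. by rewrite mulr_ge0// ltW. Qed.

Lemma er_map_ereal_sup_cvg x :
  (Psi (g N x * c) * v x)%:E @[N --> \oo] -->
  (er_map Psi (ereal_sup (range (fun N => (g N x)%:E)) * c%:E) * (v x)%:E)%E.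
Proof.
rewrite -(er_map_ereal_sup (g := g ^~ x))//.
under eq_fun do rewrite EFinM.
apply: cvgeZr => //; apply: ereal_nondecreasing_cvgn => N M NM.
by rewrite lee_fin; apply: (growth_le gP) => //; rewrite ler_wpM2r ?gmono// ltW.
Qed.

Let mh N : measurable_fun setT (fun x => (Psi (g N x * c) * v x)%:E).
Proof.
apply/measurable_EFinP; apply: measurable_funM => //.
by apply: measurable_growth_comp => //; exact: measurable_funM.
Qed.

Lemma measurable_er_map_ereal_sup : measurable_fun setT (fun x =>
  er_map Psi (ereal_sup (range (fun N => (g N x)%:E)) * c%:E) * (v x)%:E)%E.
Proof.
apply: (emeasurable_fun_cvg (fun N x => (Psi (g N x * c) * v x)%:E)) => //.
by move=> x _; exact: er_map_ereal_sup_cvg.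
Qed.

(** Monotone convergence. *)
Lemma integral_er_map_ereal_sup_le (B : \bar R) :
  (forall N, \int[mu]_x (Psi (g N x * c) * v x)%:E <= B)%E ->
  (\int[mu]_x (er_map Psi (ereal_sup (range (fun N => (g N x)%:E)) * c%:E) *
    (v x)%:E) <= B)%E.
Proof.
move=> hB.
rewrite (eq_integral (fun x => limn (fun N => (Psi (g N x * c) * v x)%:E))); last first.
  by move=> x _; apply/esym/cvg_lim => //; exact: er_map_ereal_sup_cvg.
have h0 N x : setT x -> (0 <= (Psi (g N x * c) * v x)%:E)%E.
  by move=> _; rewrite lee_fin mulr_ge0// (growth_ge0 gP).
have nd x : setT x -> nondecreasing_seq (fun N => (Psi (g N x * c) * v x)%:E).
  move=> _ N M NM; rewrite lee_fin ler_wpM2r//.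
  by apply: (growth_le gP) => //; rewrite ler_wpM2r ?gmono// ltW.
rewrite (monotone_convergence mu measurableT mh h0 nd).
apply: lime_le; last exact: nearW.
apply: ereal_nondecreasing_is_cvgn => N M NM.
apply: ge0_le_integral => //; [exact: h0|by move=> x _; exact: nd].
Qed.

End MonotoneLimit.
End OrliczTools.

(** * Weights on cubes *)

Section AbsWeights.
Context {R : realType} {disp} {T : measurableType disp} (mu : {measure set T -> \bar R}).
Variables (w : T -> R).
Hypotheses (mw : measurable_fun setT w) (wpos : {ae mu, forall x, 0 < w x}).

(** A weight is positive almost everywhere only; its absolute value is a
nonnegative density with the same integrals. *)
Lemma integral_mul_abs (D : set T) (f : T -> \bar R) : measurable D ->
  measurable_fun setT f ->
  (\int[mu]_(x in D) (f x * (w x)%:E) = \int[mu]_(x in D) (f x * `|w x|%:E))%E.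
Proof.
move=> mD mf; apply: ae_eq_integral => //.
- apply: (measurable_funS measurableT) => //; apply: emeasurable_funM => //.
  exact/measurable_EFinP.
- apply: (measurable_funS measurableT) => //; apply: emeasurable_funM => //.
  by apply/measurable_EFinP; exact: measurableT_comp.
- by move: wpos; apply: filterS => x wx _; rewrite gtr0_norm.
Qed.

(** If the integral vanished, [w] would be both zero and positive almost everywhere
on [D]. *)
Lemma integral_abs_gt0 (D : set T) : measurable D -> (0 < mu D)%E ->
  (0 < \int[mu]_(x in D) `|w x|%:E)%E.
Proof.
move=> mD muD; rewrite lt_neqAle; apply/andP; split; last first.
  by apply: integral_ge0 => x _; rewrite lee_fin.
apply/eqP => int0.
have /(ae_eq_integral_abs mu mD) : measurable_fun D (EFin \o w).
  by apply/measurable_EFinP; exact: measurable_funTS.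
case=> [+ _].
rewrite [X in X = _ -> _](_ : _ = \int[mu]_(x in D) `|w x|%:E)%E// => /(_ (esym int0)) w0.
have [N [mN N0 sub]] : {ae mu, forall x, ~ D x}.
  move: w0 wpos; apply: filterS2 => x h wx Dx.
  by have := h Dx; rewrite /= => -[wx0]; rewrite wx0 ltxx in wx.
have DN : D `<=` N by move=> x Dx; apply: sub => /=; exact.
have : (mu D <= mu N)%E by apply: le_measure; rewrite ?inE.
by rewrite N0 leNgt muD.
Qed.

End AbsWeights.

Section WeightsOnCubes.
Context {R : realType} {d : nat}.
Hypothesis hd : (0 < d)%N.
Variable w : Rd R d -> R.
Hypothesis ww : weight w.

Lemma weight_measurable : measurable_fun setT w.
Proof. by case: ww => -[]. Qed.

Lemma weight_abs_measurable : measurable_fun setT (fun x => `|w x|).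
Proof. exact: measurableT_comp weight_measurable. Qed.

Lemma weight_cube_fin (a : 'I_d -> R) s :
  (\int[leb R d]_(x in cube a s) `|w x|%:E < +oo)%E.
Proof.
have [[_ loc] _] := ww.
pose K : set 'rV[R]_d := [set u | forall i, `[a i, a i + s]%classic (u ord0 i)].
have cK : compact K.
  apply: (@rV_compact R d (fun i => `[a i, a i + s]%classic)) => i.
  exact: segment_compact.
have := loc _ cK.
rewrite (_ : [set x | _] = cube a s); last first.
  by apply/seteqP; split => x h i; have := h i; rewrite /= in_itv/= mxE.
by move=> /integrableP[_].
Qed.

Lemma weight_cube_gt0 (a : 'I_d -> R) s : 0 < s ->
  (0 < \int[leb R d]_(x in cube a s) `|w x|%:E)%E.
Proof.
move=> s0; apply: integral_abs_gt0.
- exact: weight_measurable.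
- by case: ww.
- exact: measurable_cube.
- by rewrite leb_cube// lte_fin exprn_gt0.
Qed.

Lemma weight_measure_cube (a : 'I_d -> R) s :
  weight_measure w (cube a s) = (\int[leb R d]_(x in cube a s) `|w x|%:E)%E.
Proof.
rewrite /weight_measure.
have := @integral_mul_abs _ _ _ (leb R d) w weight_measurable (ww.2) (cube a s)
  (cst 1%E) (measurable_cube a s) (@measurable_cst _ _ _ _ _ _).
by under eq_integral do rewrite mul1e; under [X in _ = X -> _]eq_integral do rewrite mul1e.
Qed.

End WeightsOnCubes.

Section DensityFinite.
Context {R : realType} {disp} {T : measurableType disp} (mu : {measure set T -> \bar R}).
Variables (Phi : R -> R) (gP : growth_pos Phi) (F w : T -> R).
Hypotheses (mF : measurable_fun setT F) (F0 : forall x, 0 <= F x).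
Hypotheses (mw : measurable_fun setT w) (w0 : forall x, 0 <= w x).
Hypothesis PhiF : (\int[mu]_x (Phi (F x) * w x)%:E <= 1)%E.

(** [F] is at most [1 + Phi F / Phi 1], since [Phi t / t] is nondecreasing. *)
Lemma density_fin (D : set T) : measurable D ->
  (\int[mu]_(x in D) (w x)%:E < +oo)%E -> (\int[mu]_(x in D) (F x * w x)%:E < +oo)%E.
Proof.
move=> mD wfin.
have P1 := gp_pos gP (@ltr01 R).
have mPF' : measurable_fun setT (fun x => (Phi (F x) * w x)%:E).
  apply/measurable_EFinP; apply: measurable_funM => //.
  exact: measurable_growth_comp.
have mPF : measurable_fun setT (fun x => ((Phi 1)^-1 * (Phi (F x) * w x))%:E).
  by apply/measurable_EFinP; apply: measurable_funM => //; exact/measurable_EFinP.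
have mw' : measurable_fun setT (fun x => (w x)%:E) by exact/measurable_EFinP.
have PF0 x : 0 <= (Phi 1)^-1 * (Phi (F x) * w x).
  by rewrite mulr_ge0 ?invr_ge0 ?(ltW P1)// mulr_ge0// (growth_ge0 gP).
apply: (@le_lt_trans _ _ (\int[mu]_(x in D) ((w x)%:E +
     ((Phi 1)^-1 * (Phi (F x) * w x))%:E))%E).
  apply: ge0_le_integral => //.
  - by move=> x _; rewrite lee_fin mulr_ge0.
  - by apply: measurable_funTS; apply/measurable_EFinP; exact: measurable_funM.
  - by apply: emeasurable_funD; exact: measurable_funTS.
  move=> x _; rewrite -EFinD lee_fin mulrA -{2}[w x]mul1r -mulrDl.
  apply: ler_wpM2r => //.
  have [F1|F1] := leP (F x) 1.
    by rewrite (le_trans F1)// lerDl mulr_ge0 ?invr_ge0 ?(ltW P1)// (growth_ge0 gP).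
  have := growth_ratio_le gP ltr01 (ltW F1); rewrite divr1 => h.
  have : F x <= (Phi 1)^-1 * Phi (F x) by rewrite mulrC ler_pdivlMr// mulrC.
  by lra.
rewrite ge0_integralD//.
- apply: lte_add_pinfty => //.
  apply: (@le_lt_trans _ _ (\int[mu]_x ((Phi 1)^-1 * (Phi (F x) * w x))%:E)%E).
    by apply: ge0_subset_integral => // x _; rewrite lee_fin.
  under eq_integral do rewrite EFinM.
  rewrite ge0_integralZl//.
  + apply: (@le_lt_trans _ _ (((Phi 1)^-1)%:E * 1)%E).
      by rewrite lee_wpmul2l// lee_fin invr_ge0 ltW.
    by rewrite mule1 ltry.
  + by move=> x _; rewrite lee_fin mulr_ge0// (growth_ge0 gP).
  + by rewrite lee_fin invr_ge0 ltW.
- by move=> x _; rewrite lee_fin.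
- exact: measurable_funTS.
- by move=> x _; rewrite lee_fin.
- exact: measurable_funTS.
Qed.

End DensityFinite.

Section TestFunctions.
Context {R : realType} {d : nat}.
Variables (w : Rd R d -> R) (Q : set (Rd R d)).
Hypotheses (ww : weight w) (mQ : measurable Q).

Lemma modulus_weight_indic y : modulus (w y * \1_Q y)%:C%C = `|w y| * \1_Q y.
Proof. by rewrite modulus_real normrM (ger0_norm (_ : 0 <= \1_Q y)). Qed.

Lemma measurable_weight_indic :
  measurable_fun setT (fun y => modulus (w y * \1_Q y)%:C%C).
Proof.
rewrite (_ : (fun y => _) = (fun y => `|w y| * \1_Q y)).
  exact: (measurable_funM (weight_abs_measurable ww) (measurable_indic mQ)).
by apply/funext => y; exact: modulus_weight_indic.
Qed.

Lemma weight_indic_fin (a : 'I_d -> R) s :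
  (\int[leb R d]_(y in cube a s) (modulus (w y * \1_Q y)%:C%C)%:E < +oo)%E.
Proof.
apply: le_lt_trans (weight_cube_fin ww a s).
apply: (@ge0_le_integral _ _ _ (leb R d) _ (measurable_cube a s)).
- by move=> x _; rewrite lee_fin modulus_ge0.
- by apply: measurable_funTS; apply/measurable_EFinP; exact: measurable_weight_indic.
- by apply: measurable_funTS; apply/measurable_EFinP; exact: weight_abs_measurable.
by move=> x _; rewrite modulus_weight_indic lee_fin ler_piMr.
Qed.

End TestFunctions.

Lemma measurable_er_map_maximal (R : realType) (d n : nat) (hd : (0 < d)%N)
    (hn : (0 < n)%N) (alpha : R) (alpha0 : 0 <= alpha) (f : 'I_n -> Rd R d -> R[i])
    (mf : forall j, measurable_fun setT (fun y => modulus (f j y)))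
    (f_fin : forall j (a : 'I_d -> R) s, 0 < s ->
      (\int[leb R d]_(y in cube a s) (modulus (f j y))%:E < +oo)%E)
    (Psi : R -> R) (gP : growth_pos Psi) (c : R) : 0 < c ->
  measurable_fun setT (fun x => er_map Psi (maximal alpha f x * c%:E))%E.
Proof.
move=> c0; have := @measurable_er_map_ereal_sup R _ (Rd R d) Psi gP
  (max_first alpha f) (cst 1) c c0 (max_first_ge0 alpha f)
  (max_first_le alpha f) (measurable_max_first alpha f) (@measurable_cst _ _ _ _ _ _).
apply: eq_measurable_fun => x _.
by rewrite mule1 -(maximal_sup_max_first hd hn alpha0 mf f_fin).
Qed.

(** * The modular estimate *)

Section MainEstimate.
Context {R : realType} {d n : nat}.
Hypotheses (hd : (0 < d)%N) (hn : (0 < n)%N).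
Variables (alpha : R) (Phi : 'I_n -> R -> R) (Psi : R -> R) (D : R) (C : 'I_n -> R).
Hypothesis alpha0 : 0 <= alpha.
Hypotheses (gPhi : forall j, growth_pos (Phi j)) (gPsi : growth_pos Psi).
Hypothesis mono : forall j, nondecreasing_pos (fun t => Psi t / Phi j t).
Hypothesis (D1 : 1 <= D).
Hypothesis (hD : forall s t : R, 0 <= s -> 0 <= t -> Psi (s * t) <= D * Psi s * Psi t).
Hypothesis C0 : forall j, 0 < C j.
Hypothesis hC : forall j, dyadic_sums_le (Phi j) (C j).
Local Notation E := (Rd R d).
Variables (sigma : 'I_n -> E -> R) (v : E -> R) (K : R).
Hypotheses (wsigma : forall j, weight (sigma j)) (wv : weight v) (K0 : 0 <= K).

Let w j x := `|sigma j x|.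
Let vv x := `|v x|.
Let tf (Q : set E) : 'I_n -> E -> R[i] := fun j y => (sigma j y * \1_Q y)%:C%C.

Hypothesis test : forall (a : 'I_d -> R) (s : R), 0 < s ->
  ((\prod_j Psi (growth_inv (Phi j) (fine (\int[leb R d]_(x in cube a s) (w j x)%:E)%E)^-1))%:E *
   \int[leb R d]_(x in cube a s) (er_map Psi (maximal alpha (tf (cube a s)) x) * (vv x)%:E)
   <= K%:E)%E.

Variable F : 'I_n -> E -> R.
Hypotheses (mF : forall j, measurable_fun setT (F j)) (F0 : forall j x, 0 <= F j x).
Hypothesis PhiF : forall j, (\int[leb R d]_x (Phi j (F j x) * w j x)%:E <= 1)%E.

Let mw j : measurable_fun setT (w j). Proof. exact: weight_abs_measurable. Qed.
Let w0 j x : 0 <= w j x. Proof. exact: normr_ge0. Qed.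
Let mFw j : measurable_fun setT (fun x => (F j x * w j x)%:E).
Proof. by apply/measurable_EFinP; exact: (measurable_funM (mF j) (mw j)). Qed.

Lemma density_cube_fin j (a : 'I_d -> R) s :
  (\int[leb R d]_(x in cube a s) (F j x * w j x)%:E < +oo)%E.
Proof.
exact: (density_fin (gPhi j) (mF j) (F0 j) (mw j) (w0 j) (PhiF j)
  (measurable_cube a s) (weight_cube_fin (wsigma j) a s)).
Qed.

Let mwE j : measurable_fun setT (fun x => (w j x)%:E).
Proof. by apply/measurable_EFinP; exact: mw. Qed.

Let wE0 j x : (0 <= (w j x)%:E)%E. Proof. by rewrite lee_fin. Qed.
Let FwE0 j x : (0 <= (F j x * w j x)%:E)%E. Proof. by rewrite lee_fin mulr_ge0. Qed.

Let modulus_tf Q j y : modulus (tf Q j y) = w j y * \1_Q y.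
Proof. exact: modulus_weight_indic. Qed.

Let mtf Q (mQ : measurable Q) j : measurable_fun setT (fun y => modulus (tf Q j y)).
Proof. exact: measurable_weight_indic. Qed.

Let tf_fin Q (mQ : measurable Q) j (a : 'I_d -> R) s : 0 < s ->
  (\int[leb R d]_(y in cube a s) (modulus (tf Q j y))%:E < +oo)%E.
Proof. by move=> _; exact: weight_indic_fin. Qed.

Section HalfOpenFamily.
Variables (I : finType) (Q : I -> set E).
Hypothesis hQ : forall i, exists a s, 0 < s /\ Q i = hcube a s.
Hypothesis Qinj : injective Q.
Hypothesis nested : forall i j x, Q i x -> Q j x -> Q i `<=` Q j \/ Q j `<=` Q i.

Let S j i : R := fine (\int[leb R d]_(x in Q i) (w j x)%:E).
Definition family_mass j i : R := fine (\int[leb R d]_(x in Q i) (F j x * w j x)%:E).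
Let kap i : R := frac_coef (d := d) (n := n) alpha (vol (Q i)).

Let mQ i : measurable (Q i).
Proof. by have [a [s [_ ->]]] := hQ i; exact: measurable_hcube. Qed.

Let SE j i : (\int[leb R d]_(x in Q i) (w j x)%:E = (S j i)%:E)%E.
Proof.
rewrite /S fineK//; have [a [s [s0 ->]]] := hQ i.
rewrite -(integral_cube_hcube a hd s0 (mwE j) (wE0 j)) ge0_fin_numE.
  exact: weight_cube_fin.
by apply: integral_ge0 => x _; exact: wE0.
Qed.

Let S_gt0 j i : 0 < S j i.
Proof.
rewrite -lte_fin -SE; have [a [s [s0 ->]]] := hQ i.
rewrite -(integral_cube_hcube a hd s0 (mwE j) (wE0 j)).
exact: weight_cube_gt0.
Qed.

Lemma family_massE j i :
  (\int[leb R d]_(x in Q i) (F j x * w j x)%:E = (family_mass j i)%:E)%E.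
Proof.
rewrite /family_mass fineK//; have [a [s [s0 ->]]] := hQ i.
rewrite -(integral_cube_hcube a hd s0 (mFw j) (FwE0 j)) ge0_fin_numE.
  exact: density_cube_fin.
by apply: integral_ge0 => x _; exact: FwE0.
Qed.

(** Each cube of the family inside [Q r] is replaced by its closure, over which the
integrals of the restricted weights are at least as large. *)
Let local_maximal_le (r : I) (a : 'I_d -> R) (s : R) (x : E) : Q r = hcube a s ->
  ((local_maximal Q S kap r x)%:E <= maximal alpha (tf (cube a s)) x)%E.
Proof.
move=> rE; pose mtf' := mtf (measurable_cube a s); pose tff := tf_fin (measurable_cube a s).
rewrite /local_maximal.
have [->|[i /asboolP ir ->]] := bigmaxr_attained (fun i => `[< Q i `<=` Q r >])
    (fun i => \1_(Q i) x * (kap i * \prod_j S j i)).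
  exact: (maximal_ge0 hd hn alpha0 mtf' tff).
rewrite indicE; case: (boolP (x \in Q i)) => [|_]; last first.
  by rewrite mul0r; exact: (maximal_ge0 hd hn alpha0 mtf' tff).
rewrite inE mul1r => xi.
have [b [t [t0 iE]]] := hQ i.
apply: (@le_trans _ _ (\1_(cube b t) x * cube_avg alpha (tf (cube a s)) b t)%:E); last first.
  rewrite -(maximal_termE hn alpha tff b x t0); apply: ereal_sup_ubound.
  by exists (cube b t) => //; exists b, t.
have sub : hcube b t `<=` hcube a s by rewrite -iE -rE.
rewrite indicE mem_set ?mul1r; last by apply: hcube_sub_cube; rewrite -iE.
rewrite lee_fin /cube_avg /kap iE /vol leb_hcube//=.
apply: ler_wpM2l; first by rewrite frac_coef_ge0// exprn_ge0// ltW.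
apply: ler_prod => j _; rewrite (ltW (S_gt0 _ _))/=.
rewrite -lee_fin -SE -(cube_massE tff j b t0) iE.
apply: (@le_trans _ _ (\int[leb R d]_(y in hcube b t) (modulus (tf (cube a s) j y))%:E)%E).
  rewrite le_eqVlt; apply/orP; left; apply/eqP; apply: eq_integral => y.
  rewrite inE => /sub/hcube_sub_cube yc.
  by rewrite modulus_tf indicE mem_set// mulr1.
have mt : measurable_fun (cube b t : set E) (fun y => (modulus (tf (cube a s) j y))%:E).
  by apply: measurable_funTS; apply/measurable_EFinP; exact: mtf'.
apply: (@ge0_subset_integral _ _ _ (leb R d) _ _ (measurable_hcube b t)
  (measurable_cube b t) _ mt _ (@hcube_sub_cube _ _ b t)).
by move=> y _; rewrite lee_fin modulus_ge0.
Qed.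

Let vv0 x : 0 <= vv x. Proof. exact: normr_ge0. Qed.
Let mvv : measurable_fun setT vv. Proof. exact: weight_abs_measurable. Qed.

Let measurable_test (P : set E) (mP : measurable P) :
  measurable_fun setT (fun x => er_map Psi (maximal alpha (tf P) x) * (vv x)%:E)%E.
Proof.
apply: emeasurable_funM; last by apply/measurable_EFinP; exact: mvv.
have := measurable_er_map_maximal hd hn alpha0 (mtf mP) (tf_fin mP) gPsi ltr01.
by apply: eq_measurable_fun => x _; rewrite mule1.
Qed.

Let family_test r :
  ((\prod_j Psi (growth_inv (Phi j) (S j r)^-1))%:E *
   \int[leb R d]_(x in Q r) (Psi (local_maximal Q S kap r x) * vv x)%:E <= K%:E)%E.
Proof.
have [a [s [s0 rE]]] := hQ r; apply: le_trans (test a s0).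
have SrE j : S j r = fine (\int[leb R d]_(x in cube a s) (w j x)%:E).
  by rewrite /S rE (integral_cube_hcube a hd s0 (mwE j) (wE0 j)).
under eq_bigr do rewrite SrE.
apply: lee_wpmul2l.
  rewrite lee_fin prodr_ge0// => j _; apply: (growth_ge0 gPsi).
  by apply: (growth_inv_ge0 (gPhi j)); rewrite invr_ge0 -SrE ltW.
have kap0 i : 0 <= kap i by rewrite frac_coef_ge0// fine_ge0.
have lm0 x : 0 <= Psi (local_maximal Q S kap r x).
  by apply: (growth_ge0 gPsi); exact: local_maximal_ge0.
have mlm : measurable_fun (Q r) (fun x => (Psi (local_maximal Q S kap r x) * vv x)%:E).
  apply: measurable_funTS; apply/measurable_EFinP; apply: measurable_funM; last exact: mvv.
  apply: (measurable_growth_comp gPsi); first by move=> x; exact: local_maximal_ge0.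
  apply: measurable_bigmaxr => i.
  exact: (measurable_funM (measurable_indic (mQ i)) (@measurable_cst _ _ _ _ _ _)).
have mt := measurable_test (measurable_cube a s).
apply: (@le_trans _ _ (\int[leb R d]_(x in Q r)
    (er_map Psi (maximal alpha (tf (cube a s)) x) * (vv x)%:E))%E).
  apply: (@ge0_le_integral _ _ _ (leb R d) _ (mQ r)).
  - by move=> x _; rewrite lee_fin mulr_ge0.
  - exact: mlm.
  - exact: measurable_funTS mt.
  move=> x _; rewrite EFinM; apply: lee_wpmul2r; first by rewrite lee_fin.
  apply: growth_er_map_le => //; first exact: local_maximal_ge0.
  exact: local_maximal_le.
have sub : Q r `<=` cube a s by rewrite rE; exact: hcube_sub_cube.
apply: (@ge0_subset_integral _ _ _ (leb R d) _ _ (mQ r)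
  (measurable_cube a s) _ (measurable_funTS mt) _ sub).
move=> x _; apply: mule_ge0; last by rewrite lee_fin.
have := maximal_ge0 hd hn alpha0 (mtf (measurable_cube a s)) (tf_fin (measurable_cube a s)) x.
by move=> /(growth_er_map_le gPsi (lexx 0)); rewrite (growth0 gPsi).
Qed.

(** The testing condition on closed cubes implies the discrete one: faces have
measure zero, and on [Q r] the local maximal function is at most the maximal
function of the weights restricted to the closure of [Q r]. *)
Lemma half_open_family_bound :
  (\int[leb R d]_x (Psi (\big[Num.max/0]_i (\1_(Q i) x *
      (frac_coef (d := d) (n := n) alpha (vol (Q i)) * \prod_j family_mass j i))) * vv x)%:E
   <= (D ^+ n * (D * Psi 4) ^+ n * (\prod_j C j) * K)%:E)%E.
Proof.
have kap0 i : 0 <= kap i by rewrite frac_coef_ge0// fine_ge0.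
exact: (carleson_max_bound mQ Qinj nested hn gPhi gPsi mono D1 hD C0 hC mw w0 mF F0
  mvv vv0 SE family_massE PhiF S_gt0 K0 kap0 family_test).
Qed.

End HalfOpenFamily.
Section AllCubes.
Variables (f : 'I_n -> E -> R[i]) (lam : 'I_n -> R).
Hypothesis lam0 : forall j, 0 < lam j.
Hypothesis modf : forall j y, modulus (f j y) = lam j * (F j y * w j y).

Let mFwE j : measurable_fun setT (fun x => F j x * w j x).
Proof. exact: measurable_funM (mF j) (mw j). Qed.

Lemma measurable_modulus_density j : measurable_fun setT (fun y => modulus (f j y)).
Proof.
rewrite (_ : (fun y => _) = (fun y => lam j * (F j y * w j y))).
  exact: (measurable_funM (@measurable_cst _ _ _ _ _ (lam j)) (mFwE j)).
by apply/funext => y; exact: modf.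
Qed.

Let mass_scale j (P : set E) : measurable P ->
  (\int[leb R d]_(y in P) (modulus (f j y))%:E =
   (lam j)%:E * \int[leb R d]_(y in P) (F j y * w j y)%:E)%E.
Proof.
move=> mP; under eq_integral do rewrite modf EFinM.
apply: (@ge0_integralZl _ _ _ (leb R d) _ mP).
- exact: measurable_funTS (mFw j).
- by move=> y _; exact: FwE0.
- by rewrite lee_fin ltW.
Qed.

Lemma modulus_density_fin j (a : 'I_d -> R) s : 0 < s ->
  (\int[leb R d]_(y in cube a s) (modulus (f j y))%:E < +oo)%E.
Proof.
move=> s0; rewrite mass_scale; last exact: measurable_cube.
have := density_cube_fin j a s.
rewrite -ge0_fin_numE; last by apply: integral_ge0 => y _; exact: FwE0.
by move=> /fineK <-; rewrite -EFinM ltry.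
Qed.

(** The number of grids, times the cost [D * Psi (6^(d n))] of passing from a cube
to a dyadic one with side at most 6 times larger, times the constant of
[carleson_max_bound]. *)
Definition estimate_const : R :=
  #|{ffun 'I_d -> bool}|%:R * ((D * Psi ((6 ^+ d) ^+ n)) *
    (D ^+ n * (D * Psi 4) ^+ n * \prod_j C j)).

(** The cubes are distributed among the [2^d] grids, and the grids are treated
separately. *)
Lemma max_first_bound N :
  (\int[leb R d]_x (Psi (max_first alpha f N x / \prod_j lam j) * vv x)%:E
    <= (estimate_const * K)%:E)%E.
Proof.
(* Any top side that exceeds three times all the sides will do. *)
pose L0 : R := 1 + \sum_(m < N) 3 * @qside R d m.
have sL (m : 'I_N) : 3 * @qside R d m < L0 :> R.
  rewrite /L0 (bigD1 m)//= addrCA ltrDl ltr_pwDl// sumr_ge0// => i _.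
  by rewrite mulr_ge0// ltW ?qside_gt0.
have L00 : 0 < L0.
  by rewrite /L0 ltr_pwDl// sumr_ge0// => i _; rewrite mulr_ge0// ltW ?qside_gt0.
have /fin_all_exists[g hg] (m : 'I_N) : exists p : {ffun 'I_d -> bool} * nat * {ffun 'I_d -> int},
   (cube (qcorner m) (@qside R d m) : set E) `<=` dyadic L0 p.1.1 p.1.2 p.2 /\
   L0 / 2 ^+ p.1.2 <= 6 * @qside R d m.
  have [e [k [z h]]] := cube_sub_dyadic (@qcorner R d m) (@qside_gt0 R d m) (sL m).
  by exists (e, k, z).
pose dy (m : 'I_N) : set E := dyadic L0 (g m).1.1 (g m).1.2 (g m).2.
pose fam e : seq (set E) := [seq dy m | m <- enum 'I_N & (g m).1.1 == e].
(* Indexing by the sets themselves makes the family injective. *)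
pose I e : finType := seq_sub (fam e).
pose Q e (i : I e) : set E := ssval i.
have QE e (i : I e) : exists k z, Q e i = dyadic L0 e k z.
  have /mapP[m] := ssvalP i; rewrite mem_filter => /andP[/eqP em _] im.
  by exists (g m).1.2, (g m).2; rewrite /Q im /dy em.
have Qh e (i : I e) : exists a s, 0 < s /\ Q e i = hcube a s.
  have [k [z ->]] := QE e i; rewrite /dyadic.
  by eexists; exists (L0 / 2 ^+ k); split; [rewrite divr_gt0// exprn_gt0|].
have Qinj e : injective (Q e) by exact: val_inj.
have nested e (i j : I e) x : Q e i x -> Q e j x -> Q e i `<=` Q e j \/ Q e j `<=` Q e i.
  have [k [z ->]] := QE e i; have [k' [z' ->]] := QE e j => xi xj.
  have [kk|/ltnW kk] := leqP k k'.
    by right; exact: (dyadic_sub L00 kk xi xj).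
  by left; exact: (dyadic_sub L00 kk xj xi).
pose X e x := \big[Num.max/0]_i (\1_(Q e i) x *
      (frac_coef (d := d) (n := n) alpha (vol (Q e i)) * \prod_j family_mass (Q e) j i)).
have X0 e x : 0 <= X e x by exact: bigmax_ge_id.
have vv0' x : 0 <= vv x by exact: normr_ge0.
have PX0 e x : 0 <= Psi (X e x) * vv x by rewrite mulr_ge0// (growth_ge0 gPsi).
pose c := D * Psi ((6 ^+ d) ^+ n).
have c0 : 0 <= c by rewrite mulr_ge0 ?(le_trans ler01 D1)// (growth_ge0 gPsi)// !exprn_ge0.
pose Lam := \prod_j lam j.
have Lam0 : 0 < Lam by apply: prodr_gt0.
have key x : Psi (max_first alpha f N x / Lam) * vv x <= \sum_e c * (Psi (X e x) * vv x).
  have S0 : 0 <= \sum_e c * (Psi (X e x) * vv x).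
    by apply: sumr_ge0 => e _; exact: mulr_ge0.
  rewrite /max_first.
  have [->|[m _ ->]] := bigmaxr_attained predT (fun m : 'I_N =>
      \1_(cube (qcorner m) (@qside R d m)) x * cube_avg alpha f (qcorner m) (@qside R d m)).
    by rewrite mul0r (growth0 gPsi) mul0r.
  rewrite indicE; case: (boolP (x \in _)) => [|_]; last first.
    by rewrite !mul0r (growth0 gPsi) mul0r.
  rewrite inE mul1r => xm.
  have [sub Lm] := hg m; set e := (g m).1.1 in sub.
  have mfam : dy m \in fam e by apply: map_f; rewrite mem_filter eqxx mem_enum.
  pose i : I e := SeqSub mfam.
  apply: (@le_trans _ _ (c * (Psi (X e x) * vv x))); last first.
    by rewrite (bigD1 e)//= lerDl sumr_ge0// => e' _; exact: mulr_ge0.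
  rewrite mulrA; apply: ler_wpM2r => //.
  apply: (@le_trans _ _ (Psi ((6 ^+ d) ^+ n * X e x))); last first.
    by apply: hD => //; rewrite !exprn_ge0.
  have qm0 := @qside_gt0 R d m.
  apply: (growth_le gPsi).
    apply: divr_ge0; last exact: ltW.
    exact: cube_avg_ge0.
  apply: (@le_trans _ _ ((6 ^+ d) ^+ n *
      (frac_coef (d := d) (n := n) alpha (vol (Q e i)) *
       \prod_j family_mass (Q e) j i))); last first.
    apply: ler_wpM2l; first by rewrite !exprn_ge0.
    apply: le_trans (le_bigmax _ (fun i => \1_(Q e i) x *
      (frac_coef (d := d) (n := n) alpha (vol (Q e i)) * \prod_j family_mass (Q e) j i)) i).
    by rewrite indicE mem_set ?mul1r//; exact: sub.
  have side0 : 0 < L0 / 2 ^+ (g m).1.2 by rewrite divr_gt0// exprn_gt0.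
  have volE : vol (Q e i) = (L0 / 2 ^+ (g m).1.2) ^+ d.
    by rewrite /vol /Q /= /dy /dyadic leb_hcube.
  have mass j : cube_mass f j (qcorner m) (@qside R d m) <= lam j * family_mass (Q e) j i.
    rewrite -lee_fin -(cube_massE modulus_density_fin j _ qm0) EFinM.
    rewrite -(family_massE (Qh e)) -mass_scale; last first.
      by have [a [s [_ ->]]] := Qh e i; exact: measurable_hcube.
    have mD : measurable (dy m : set E) by exact: measurable_hcube.
    apply: (@ge0_subset_integral _ _ _ (leb R d) _ _ (measurable_cube _ _) mD _ _ _ sub).
      by apply: measurable_funTS; apply/measurable_EFinP; exact: measurable_modulus_density.
    by move=> y _; rewrite lee_fin modulus_ge0.
  rewrite ler_pdivrMr// mulrA -[leRHS]mulrA /cube_avg; apply: ler_pM.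
  - by rewrite frac_coef_ge0// exprn_ge0// ltW.
  - by rewrite prodr_ge0// => j _; exact: cube_mass_ge0.
  - rewrite volE; apply: frac_coef_le => //; first exact: exprn_gt0.
      pose b i := ((g m).1.1 i)%:R * (L0 / 3) +
        L0 / 2 ^+ (g m).1.2 * ((g m).2 i)%:~R.
      rewrite -lee_fin -(leb_cube (qcorner m) qm0) -(leb_hcube b hd side0).
      apply: le_measure; rewrite ?inE; [exact: measurable_cube|exact: measurable_hcube|exact: sub].
    by rewrite -exprMn; apply: lerXn2r; rewrite ?nnegrE ?mulr_ge0// ltW.
  - rewrite mulrC /Lam -big_split/=; apply: ler_prod => j _.
    by rewrite cube_mass_ge0/=; exact: mass.
have mvv' : measurable_fun setT vv by exact: weight_abs_measurable.
have mX e : measurable_fun setT (fun x => (Psi (X e x) * vv x)%:E).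
  apply/measurable_EFinP; apply: measurable_funM; last exact: mvv'.
  apply: (measurable_growth_comp gPsi); first exact: X0.
  apply: measurable_bigmaxr => i.
  have mQi : measurable (Q e i) by have [a [s [_ ->]]] := Qh e i; exact: measurable_hcube.
  exact: (measurable_funM (measurable_indic mQi) (@measurable_cst _ _ _ _ _ _)).
have mcX e : measurable_fun setT (fun x => (c * (Psi (X e x) * vv x))%:E).
  apply/measurable_EFinP; apply: measurable_funM; first exact: measurable_cst.
  by have /measurable_EFinP := mX e.
have Mc0 x : 0 <= max_first alpha f N x / Lam.
  by rewrite divr_ge0 ?max_first_ge0// ltW.
apply: (@le_trans _ _ (\int[leb R d]_x (\sum_e (c * (Psi (X e x) * vv x))%:E))%E).
  apply: (@ge0_le_integral _ _ _ (leb R d) _ measurableT).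
  - by move=> x _; rewrite lee_fin mulr_ge0// (growth_ge0 gPsi).
  - apply/measurable_EFinP; apply: measurable_funM; last exact: mvv'.
    apply: (measurable_growth_comp gPsi); first exact: Mc0.
    exact: (measurable_funM (measurable_max_first alpha f N) (@measurable_cst _ _ _ _ _ _)).
  - exact: emeasurable_sum_cond.
  - by move=> x _; rewrite sumEFin lee_fin.
rewrite ge0_integral_sum_cond; last 2 first.
- exact: mcX.
- by move=> e x; rewrite lee_fin mulr_ge0.
apply: (@le_trans _ _ (\sum_(e : {ffun 'I_d -> bool})
   (c * (D ^+ n * (D * Psi 4) ^+ n * \prod_j C j) * K)%:E)%E).
  apply: lee_sum => e _; under eq_integral do rewrite EFinM.
  rewrite (@ge0_integralZl _ _ _ (leb R d) _ measurableT _ (mX e)).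
  - rewrite -[c * _ * K]mulrA [leRHS]EFinM; apply: lee_wpmul2l; first by rewrite lee_fin.
    exact: (half_open_family_bound (Qh e) (Qinj e) (nested e)).
  - by move=> x _; rewrite lee_fin.
  - by rewrite lee_fin.
rewrite sumEFin sumr_const lee_fin -[leLHS]mulr_natl /estimate_const /c.
by rewrite !mulrA.
Qed.

End AllCubes.
End MainEstimate.

(** * From the modular estimate to the operator norm *)

Section LuxemburgProduct.
Context {R : realType}.

(** A quantitative continuity at [e = 0]; the shift by 2 leaves room for the
induction. *)
Lemma prod_shift_le (n : nat) (r : 'I_n -> R) (e : R) : (forall j, 0 <= r j) ->
  0 < e -> e <= 1 ->
  \prod_j (r j + e) <= \prod_j r j + e * \prod_j (r j + 2).
Proof.
move=> r0 e0 e1; elim: n r r0 => [|n IH] r r0.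
  by rewrite !big_ord0 mulr1 lerDl ltW.
rewrite !big_ord_recl /=.
set P := \prod_i r (lift ord0 i); set M := \prod_i (r (lift ord0 i) + 2).
have hP : \prod_i (r (lift ord0 i) + e) <= P + e * M by exact: IH.
have PM : P <= M by apply: ler_prod => j _; rewrite r0/= lerDl ler0n.
have P0 : 0 <= P by apply: prodr_ge0.
have M0 : 0 <= M by exact: le_trans PM.
have := r0 ord0; set a := r ord0 => a0.
have ae : 0 <= a + e by lra.
apply: le_trans (ler_wpM2l ae hP) _.
have h1 : (a + e) * (P + e * M) = a * P + e * (P + (a + e) * M) by ring.
rewrite h1 lerD2l; apply: ler_wpM2l; first exact: ltW.
by nra.
Qed.

(** Passes from admissible parameters to their infima, also when some of the norms
vanish. *)
Lemma le_prod_of_gt (n : nat) (x : 'I_n -> \bar R) (y : \bar R) (B : R) : 0 <= B ->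
  (forall j, 0 <= x j < +oo)%E ->
  (forall lam : 'I_n -> R, (forall j, 0 < lam j) -> (forall j, x j < (lam j)%:E)%E ->
     (y <= (B * \prod_j lam j)%:E)%E) ->
  (y <= B%:E * \prod_j x j)%E.
Proof.
move=> B0 hx hy.
pose r j := fine (x j).
have xE j : x j = (r j)%:E.
  by have /andP[x0 xf] := hx j; rewrite /r fineK// ge0_fin_numE.
have r0 j : 0 <= r j by rewrite -lee_fin -xE; have /andP[] := hx j.
have -> : (B%:E * \prod_j x j = (B * \prod_j r j)%:E)%E.
  by rewrite EFinM -prodEFin; under eq_bigr do rewrite xE.
apply/lee_addgt0Pr => eps eps0; rewrite -EFinD.
pose M := \prod_j (r j + 2).
have M0 : 0 < M by apply: prodr_gt0 => j _; rewrite ltr_wpDl.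
pose e := Num.min 1 (eps / (B * M + 1)).
have BM : 0 < B * M + 1 by rewrite ltr_wpDl// mulr_ge0// ltW.
have e0 : 0 < e by rewrite lt_min ltr01 divr_gt0.
have e1 : e <= 1 by rewrite ge_min lexx.
have e2 : e * (B * M + 1) <= eps.
  by rewrite -ler_pdivlMr// ge_min lexx orbT.
have lam0 j : 0 < r j + e by rewrite ltr_wpDl.
apply: le_trans (hy (fun j => r j + e) lam0 _) _.
  by move=> j; rewrite xE lte_fin ltrDl.
rewrite lee_fin; apply: (@le_trans _ _ (B * (\prod_j r j + e * M))).
  by apply: ler_wpM2l => //; exact: prod_shift_le.
by rewrite mulrDr lerD2l; lra.
Qed.

End LuxemburgProduct.

Lemma estimate_const_ge0 {R : realType} (d n : nat) (Psi : R -> R) (D : R)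
    (C : 'I_n -> R) : growth_pos Psi -> 1 <= D -> (forall j, 0 < C j) ->
  0 <= @estimate_const R d n Psi D C.
Proof.
move=> gP D1 C0; have D0 : 0 <= D := le_trans ler01 D1.
have Pc (u : R) : 0 <= u -> 0 <= D * Psi u.
  by move=> u0; rewrite mulr_ge0// (growth_ge0 gP).
have PC : 0 <= \prod_j C j by apply: prodr_ge0 => j _; exact: ltW.
apply: mulr_ge0 => //; apply: mulr_ge0; first by apply: Pc; rewrite !exprn_ge0.
by rewrite mulr_ge0// mulr_ge0 ?exprn_ge0// Pc.
Qed.

Section NormBound.
Context {R : realType} {d n : nat}.
Hypotheses (hd : (0 < d)%N) (hn : (0 < n)%N).
Variables (alpha : R) (Phi : 'I_n -> R -> R) (Psi : R -> R) (A D : R) (C : 'I_n -> R).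
Hypothesis alpha0 : 0 <= alpha.
Hypotheses (gPhi : forall j, growth_pos (Phi j)) (gPsi : growth_pos Psi).
Hypothesis mono : forall j, nondecreasing_pos (fun t => Psi t / Phi j t).
Hypothesis A0 : 0 < A.
Hypothesis hA : forall s t : R, 0 <= s -> 0 < t -> Psi (s / t) <= A * Psi s / Psi t.
Hypothesis (D1 : 1 <= D).
Hypothesis (hD : forall s t : R, 0 <= s -> 0 <= t -> Psi (s * t) <= D * Psi s * Psi t).
Hypothesis C0 : forall j, 0 < C j.
Hypothesis hC : forall j, dyadic_sums_le (Phi j) (C j).
Local Notation E := (Rd R d).

(** At least 1, so that dividing by it divides the values of [Psi] at least as much
([growth_div_le]). *)
Definition norm_const : R := Num.max 1 (A * @estimate_const R d n Psi D C).

Variables (sigma : 'I_n -> E -> R) (v : E -> R).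
Hypotheses (wsigma : forall j, weight (sigma j)) (wv : weight v).
Hypothesis test_fin : (testing_constant alpha Phi Psi sigma v < +oo)%E.

Let K := fine (testing_constant alpha Phi Psi sigma v).

Let mtf Q (mQ : measurable Q) j :
  measurable_fun setT (fun y : E => modulus (sigma j y * \1_Q y)%:C%C).
Proof. exact: measurable_weight_indic. Qed.

Let tf_fin Q (mQ : measurable Q) j (a : 'I_d -> R) s : 0 < s ->
  (\int[leb R d]_(y in cube a s) (modulus (sigma j y * \1_Q y)%:C%C)%:E < +oo)%E.
Proof. by move=> _; exact: weight_indic_fin. Qed.

Let term_le (a : 'I_d -> R) (s : R) : 0 < s ->
  ((\prod_j Psi (growth_inv (Phi j)
      (fine (\int[leb R d]_(x in cube a s) `|sigma j x|%:E)%E)^-1))%:E *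
   \int[leb R d]_(x in cube a s) (er_map Psi
      (maximal alpha (fun i y => (sigma i y * \1_(cube a s) y)%:C%C) x) * `|v x|%:E)
   <= testing_constant alpha Phi Psi sigma v)%E.
Proof.
move=> s0; have mQ := @measurable_cube R d a s.
under eq_bigr do rewrite -(weight_measure_cube (wsigma _)).
rewrite -(integral_mul_abs (weight_measurable wv) wv.2 mQ).
  by apply: ereal_sup_ubound; exists (cube a s) => //; exists a, s.
have := measurable_er_map_maximal hd hn alpha0 (mtf mQ) (tf_fin mQ) gPsi ltr01.
by apply: eq_measurable_fun => x _; rewrite mule1.
Qed.

Let term_ge0 (a : 'I_d -> R) (s : R) : 0 < s ->
  (0 <= (\prod_j Psi (growth_inv (Phi j)
      (fine (\int[leb R d]_(x in cube a s) `|sigma j x|%:E)%E)^-1))%:E *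
   \int[leb R d]_(x in cube a s) (er_map Psi
      (maximal alpha (fun i y => (sigma i y * \1_(cube a s) y)%:C%C) x) * `|v x|%:E))%E.
Proof.
move=> s0; apply: mule_ge0.
  rewrite lee_fin prodr_ge0// => j _; apply: (growth_ge0 gPsi).
  apply: (growth_inv_ge0 (gPhi j)); rewrite invr_ge0 fine_ge0//.
  by apply: integral_ge0 => x _; rewrite lee_fin.
have mQ := @measurable_cube R d a s.
apply: integral_ge0 => x _; apply: mule_ge0; last by rewrite lee_fin.
have := maximal_ge0 hd hn alpha0 (mtf mQ) (tf_fin mQ) x.
by move=> /(growth_er_map_le gPsi (lexx 0)); rewrite (growth0 gPsi).
Qed.

Let testE : testing_constant alpha Phi Psi sigma v = K%:E.
Proof.
rewrite /K fineK// ge0_fin_numE//.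
by apply: le_trans (term_ge0 (fun=> 0) ltr01) (term_le _ ltr01).
Qed.

Lemma testing_fine_ge0 : 0 <= K.
Proof.
by rewrite -lee_fin -testE; apply: le_trans (term_ge0 (fun=> 0) ltr01) (term_le _ ltr01).
Qed.

Lemma norm_const_gt0 : 0 < norm_const.
Proof. by rewrite lt_max ltr01. Qed.

Section OneTuple.
Variables (f : 'I_n -> E -> R[i]) (lam : 'I_n -> R).
Hypothesis mf : forall j, measurable_complex (f j).
Hypothesis lam0 : forall j, 0 < lam j.
Hypothesis adm : forall j, (\int[leb R d]_x (er_map (Phi j)
  (`|(modulus (f j x))%:E| * ((lam j)^-1)%:E) * (sigma j x)%:E) <= 1)%E.

Let F j x := modulus (f j x) / lam j.
Let g : 'I_n -> E -> R[i] := fun j x => (sigma j x)%:C%C * f j x.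

Let F0 j x : 0 <= F j x.
Proof. by rewrite divr_ge0 ?modulus_ge0// ltW. Qed.

Let mF j : measurable_fun setT (F j).
Proof.
exact: (measurable_funM (measurable_modulus (mf j)) (@measurable_cst _ _ _ _ _ _)).
Qed.

Let modg j y : modulus (g j y) = lam j * (F j y * `|sigma j y|).
Proof.
rewrite modulusM modulus_real /F mulrC; field; by rewrite gt_eqF.
Qed.

Let PhiF j : (\int[leb R d]_x (Phi j (F j x) * `|sigma j x|)%:E <= 1)%E.
Proof.
have mPF : measurable_fun setT (fun x => (Phi j (F j x))%:E).
  by apply/measurable_EFinP; exact: (measurable_growth_comp (gPhi j) (F0 j) (mF j)).
have := integral_mul_abs (weight_measurable (wsigma j)) (wsigma j).2 measurableT mPF.
under [X in _ = X -> _]eq_integral do rewrite -EFinM.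
move=> <-; apply: le_trans (adm j); rewrite le_eqVlt; apply/orP; left; apply/eqP.
by apply: eq_integral => x _; rewrite /= ger0_norm ?modulus_ge0.
Qed.

Let mg j : measurable_fun setT (fun y => modulus (g j y)).
Proof. exact: (measurable_modulus_density wsigma mF modg). Qed.

Let g_fin j (a : 'I_d -> R) s : 0 < s ->
  (\int[leb R d]_(y in cube a s) (modulus (g j y))%:E < +oo)%E.
Proof. exact: (modulus_density_fin gPhi wsigma mF F0 PhiF lam0 modg). Qed.

Lemma measurable_weighted_maximal :
  measurable_fun setT (weighted_maximal alpha sigma f).
Proof. exact: (measurable_maximal hd hn alpha0 mg g_fin). Qed.

(** Here [M / (c t Lam)] is written as [((M / Lam) / t) / c]; division by [t]
produces the factor [1 / Psi t <= 1 / K] and division by [c] absorbs the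
constant of [max_first_bound]. *)
Lemma luxemburg_weighted_maximal_le (t : R) : 0 < t -> K <= Psi t ->
  (luxemburg Psi v (weighted_maximal alpha sigma f) <=
    (norm_const * t * \prod_j lam j)%:E)%E.
Proof.
move=> t0 Kt; have Lam0 : 0 < \prod_j lam j by apply: prodr_gt0.
set Lam := \prod_j lam j in Lam0 *.
have c0 := norm_const_gt0; have Pt0 := gp_pos gPsi t0.
have b0 : 0 < norm_const * t * Lam by rewrite !mulr_gt0.
have bi0 : 0 < (norm_const * t * Lam)^-1 by rewrite invr_gt0.
apply: ereal_inf_lbound; exists (norm_const * t * Lam) => //; split => //.
have ME x : `|weighted_maximal alpha sigma f x|%E = maximal alpha g x.
  by rewrite gee0_abs//; exact: (maximal_ge0 hd hn alpha0 mg g_fin).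
under eq_integral do rewrite ME.
have mEM := measurable_er_map_maximal hd hn alpha0 mg g_fin gPsi bi0.
rewrite (integral_mul_abs (weight_measurable wv) wv.2 measurableT mEM).
under eq_integral do rewrite (maximal_sup_max_first hd hn alpha0 mg g_fin).
have mvv := weight_abs_measurable wv.
apply: (@integral_er_map_ereal_sup_le _ _ _ (leb R d) Psi gPsi (max_first alpha g)
  (fun x => `|v x|) _ bi0 (max_first_ge0 alpha g) (max_first_le alpha g)
  (measurable_max_first alpha g) mvv (fun x => normr_ge0 (v x))) => N.
have M0 x : 0 <= max_first alpha g N x / Lam by rewrite divr_ge0 ?max_first_ge0// ltW.
have q0 : 0 <= A / (norm_const * Psi t) by rewrite divr_ge0 ?mulr_ge0 // ltW.
have mM : measurable_fun setT (fun x => (Psi (max_first alpha g N x / Lam) * `|v x|)%:E).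
  apply/measurable_EFinP; apply: measurable_funM; last exact: mvv.
  apply: (measurable_growth_comp gPsi M0).
  exact: (measurable_funM (measurable_max_first alpha g N) (@measurable_cst _ _ _ _ _ _)).
have PM0 x : (0 <= (Psi (max_first alpha g N x / Lam) * `|v x|)%:E)%E.
  by rewrite lee_fin mulr_ge0// (growth_ge0 gPsi).
apply: (@le_trans _ _ (\int[leb R d]_x ((A / (norm_const * Psi t))%:E *
    (Psi (max_first alpha g N x / Lam) * `|v x|)%:E))%E).
  apply: (@ge0_le_integral _ _ _ (leb R d) _ measurableT).
  - move=> x _; rewrite lee_fin mulr_ge0// (growth_ge0 gPsi)// mulr_ge0 ?max_first_ge0//.
    exact: ltW.
  - apply/measurable_EFinP; apply: measurable_funM; last exact: mvv.
    apply: (measurable_growth_comp gPsi).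
      by move=> x; rewrite mulr_ge0 ?max_first_ge0// ltW.
    exact: (measurable_funM (measurable_max_first alpha g N) (@measurable_cst _ _ _ _ _ _)).
  - exact: (emeasurable_funM (@measurable_cst _ _ _ _ _ _) mM).
  move=> x _; rewrite -EFinM lee_fin mulrA; apply: ler_wpM2r => //.
  have -> : max_first alpha g N x / (norm_const * t * Lam) =
      max_first alpha g N x / Lam / t / norm_const.
    by field; rewrite !gt_eqF.
  apply: le_trans (growth_div_le gPsi _ _) _.
  - by rewrite le_max lexx.
  - by rewrite divr_ge0// ltW.
  rewrite ler_pdivrMr//; apply: le_trans (hA (M0 x) t0) _.
  rewrite le_eqVlt; apply/orP; left; apply/eqP; field.
  by rewrite !gt_eqF.
rewrite (@ge0_integralZl _ _ _ (leb R d) _ measurableT _ mM); last 2 first.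
- by move=> x _; exact: PM0.
- by rewrite lee_fin.
have test (a : 'I_d -> R) (s : R) : 0 < s ->
  ((\prod_j Psi (growth_inv (Phi j)
      (fine (\int[leb R d]_(x in cube a s) `|sigma j x|%:E)%E)^-1))%:E *
   \int[leb R d]_(x in cube a s) (er_map Psi
      (maximal alpha (fun i y => (sigma i y * \1_(cube a s) y)%:C%C) x) * `|v x|%:E)
   <= K%:E)%E.
  by move=> s0; rewrite -testE; exact: term_le.
have := max_first_bound hd hn alpha0 gPhi gPsi mono D1 hD C0 hC wsigma wv
  testing_fine_ge0 test mF F0 PhiF lam0 modg N.
have Aq0 : (0 <= (A / (norm_const * Psi t))%:E)%E by rewrite lee_fin.
move=> /(lee_wpmul2l Aq0) /le_trans; apply.
rewrite -EFinM lee_fin mulrAC ler_pdivrMr ?mulr_gt0// mul1r mulrA.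
apply: ler_pM => //.
- by apply: mulr_ge0; [exact: ltW|exact: (estimate_const_ge0 _ gPsi D1 C0)].
- exact: testing_fine_ge0.
- by rewrite le_max lexx orbT.
Qed.

End OneTuple.

Lemma luxemburg_ge0 (Psi' : R -> R) (s : E -> R) (h : E -> \bar R) :
  (0 <= luxemburg Psi' s h)%E.
Proof.
by apply: le_ereal_inf_tmp => _ [l [l0 _] <-]; rewrite lee_fin ltW.
Qed.

Lemma op_bound_of_testing (t : R) : 0 < t -> K <= Psi t ->
  op_bound Phi sigma Psi v (weighted_maximal alpha sigma) (norm_const * t).
Proof.
move=> t0 Kt; have c0 := norm_const_gt0.
split; first exact: mulr_gt0.
move=> f hf; apply: le_prod_of_gt.
- by rewrite mulr_ge0// ltW.
- by move=> j; have [_ ->] := hf j; rewrite luxemburg_ge0.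
move=> lam lam0 hlam.
have /fin_all_exists[l hl] (j : 'I_n) : exists l : R, [/\ 0 < l, l <= lam j &
    (\int[leb R d]_x (er_map (Phi j) (`|(modulus (f j x))%:E| * (l^-1)%:E) *
       (sigma j x)%:E) <= 1)%E].
  have [_ [l [l0 hl] <-]] := ereal_inf_lt (hlam j).
  by rewrite lte_fin => /ltW ll; exists l; split.
have l0 j : 0 < l j by have [] := hl j.
apply: le_trans (luxemburg_weighted_maximal_le _ l0 _ t0 Kt) _.
- by move=> j; have [] := hf j.
- by move=> j; have [] := hl j.
rewrite lee_fin ler_wpM2l ?mulr_ge0 ?(ltW c0) ?(ltW t0)//.
by apply: ler_prod => j _; rewrite ltW//=; have [] := hl j.
Qed.

Lemma op_bounded_of_testing :
  op_bounded Phi sigma Psi v (weighted_maximal alpha sigma).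
Proof.
pose t := growth_inv Psi K + 1.
have i0 := growth_inv_ge0 gPsi testing_fine_ge0.
have t0 : 0 < t by rewrite ltr_wpDl.
have Kt : K <= Psi t.
  rewrite -{1}(growth_invK gPsi testing_fine_ge0); apply: (growth_le gPsi) => //.
  by rewrite lerDl.
have hb := op_bound_of_testing t0 Kt.
split; last by exists (norm_const * t).
move=> f hf; split.
  have /fin_all_exists[l hl] (j : 'I_n) : exists l : R, 0 < l /\
    (\int[leb R d]_x (er_map (Phi j) (`|(modulus (f j x))%:E| * (l^-1)%:E) *
       (sigma j x)%:E) <= 1)%E.
    have [_ /ereal_inf_lt[_ [l [l0 hl] _] _]] := hf j.
    by exists l.
  apply: (@measurable_weighted_maximal f l).
  - by move=> j; have [] := hf j.
  - by move=> j; have [] := hl j.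
  - by move=> j; have [] := hl j.
apply: le_lt_trans (hb.2 f hf) _.
have xE j : luxemburgC (Phi j) (sigma j) (f j) = (fine (luxemburgC (Phi j) (sigma j) (f j)))%:E.
  by rewrite fineK// ge0_fin_numE ?luxemburg_ge0//; have [] := hf j.
by under eq_bigr do rewrite xE; rewrite prodEFin -EFinM ltry.
Qed.

(** [t] exceeds [Psi^-1 K] by an arbitrarily small amount, since [t] must be
positive. *)
Lemma op_norm_of_testing :
  (op_norm Phi sigma Psi v (weighted_maximal alpha sigma) <=
     (norm_const * growth_inv Psi K)%:E)%E.
Proof.
have c0 := norm_const_gt0; have i0 := growth_inv_ge0 gPsi testing_fine_ge0.
apply/lee_addgt0Pr => e e0; pose t := growth_inv Psi K + e / norm_const.
have ec : 0 < e / norm_const by rewrite divr_gt0.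
have t0 : 0 < t by rewrite ltr_wpDl.
have Kt : K <= Psi t.
  rewrite -{1}(growth_invK gPsi testing_fine_ge0); apply: (growth_le gPsi) => //.
  by rewrite lerDl ltW.
rewrite -EFinD (_ : _ + e = norm_const * t).
  by apply: ereal_inf_lbound; exists (norm_const * t) => //; exact: op_bound_of_testing.
by rewrite /t mulrDr mulrCA divff ?mulr1// gt_eqF.
Qed.

End NormBound.

Theorem theorem3p7 (R : realType) (d n : nat) (hd : (0 < d)%N) (hn : (0 < n)%N)
    (alpha : R) (halpha : 0 <= alpha < n%:R * d%:R)
    (Phi : 'I_n -> R -> R) (Psi : R -> R)
    (hPhi : forall i, class_U (Phi i) /\ nabla2 (Phi i))
    (hPsi : class_Utilde Psi)
    (hmono : forall i, nondecreasing_pos (fun t => Psi t / Phi i t)) :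
  exists2 c : R, 0 < c &
    forall (sigma : 'I_n -> Rd R d -> R) (v : Rd R d -> R),
      (forall i, weight (sigma i)) -> weight v ->
      (testing_constant alpha Phi Psi sigma v < +oo)%E ->
      op_bounded Phi sigma Psi v (weighted_maximal alpha sigma) /\
      (op_norm Phi sigma Psi v (weighted_maximal alpha sigma) <=
         (c * growth_inv Psi (fine (testing_constant alpha Phi Psi sigma v)))%:E)%E.
Proof.
have alpha0 : 0 <= alpha by case/andP: halpha.
have gPhi j : growth_pos (Phi j).
  by have [[[q _ /U_q_growth_pos]]] := hPhi j.
have [[q _ Uq] _] := hPsi.
have [Uqq DPsi _] := Uq; have gPsi := U_q_growth_pos Uqq.
have [D D1 hD] := Delta'_ge0 gPsi DPsi.
have [A A0 hA] := Utilde_div_le Uq.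
have /fin_all_exists[C hC] (j : 'I_n) : exists C, 0 < C /\ dyadic_sums_le (Phi j) C.
  by have [C C0 hC] := nabla2_dyadic_sum (gPhi j) (hPhi j).2; exists C.
have C0 j : 0 < C j by have [] := hC j.
have hC' j : dyadic_sums_le (Phi j) (C j) by have [] := hC j.
exists (@norm_const R d n Psi A D C); first exact: norm_const_gt0.
move=> sigma v wsigma wv tfin; split.
  exact: (op_bounded_of_testing hd hn alpha0 gPhi gPsi hmono A0 hA D1 hD C0 hC').
exact: (op_norm_of_testing hd hn alpha0 gPhi gPsi hmono A0 hA D1 hD C0 hC').
Qed.
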